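(* Let $i\in\{1,\dots,k\}$, let $\delta_{\phi_i}(\underline{X_{(1)}},\underline T)=T_i\,\phi_i(\underline V)$ be an estimator of $\sigma_i$, where $\phi_i$ is a real-valued measurable function of $\underline V=(T_j/T_i)_{j\ne i}$, and let $\phi_{i0}$ be the truncation of $\phi_i$ defined in the context. If there exists some $\underline\sigma=(\sigma_1,\dots,\sigma_k)$ such that $P_{\underline\sigma}\big(\phi_{i0}(\underline V)\neq\phi_i(\underline V)\big)>0$, then, under the order restriction $\sigma_1\le\sigma_2\le\cdots\le\sigma_k$, the estimator $\delta_{\phi_{i0}}(\underline{X_{(1)}},\underline T)=T_i\,\phi_{i0}(\underline V)$ dominates $\delta_{\phi_i}(\underline{X_{(1)}},\underline T)=T_i\,\phi_i(\underline V)$ with respect to the linex loss $L(\sigma_i,\delta)=\exp\{p(\delta/\sigma_i-1)\}-p(\delta/\sigma_i-1)-1$.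
   Context: Let $k\ge2$, let $n_1,\dots,n_k\ge2$ be integers, $n=\sum_{j=1}^kn_j$, and let $p\ne0$ be a fixed real number. For $i=1,\dots,k$, $(X_{i1},\dots,X_{in_i})$ is a random sample from the exponential distribution with unknown location $\mu_i\in\mathbb R$ and unknown scale $\sigma_i>0$ (density $\sigma_i^{-1}e^{-(x-\mu_i)/\sigma_i}$, $x>\mu_i$), and the $k$ samples are independent. Put $X_{i(1)}=\min_{1\le j\le n_i}X_{ij}$, $T_i=\sum_{j=1}^{n_i}(X_{ij}-X_{i(1)})$, $\underline{X_{(1)}}=(X_{1(1)},\dots,X_{k(1)})$, $\underline T=(T_1,\dots,T_k)$. Then all of $X_{1(1)},\dots,X_{k(1)},T_1,\dots,T_k$ are independent and $T_i\sim\mathrm{Gamma}(n_i-1,\sigma_i)$ (shape $n_i-1$, scale $\sigma_i$). The parameters satisfy $\sigma_1\le\cdots\le\sigma_k$. For fixed $i$, write $V_j=T_j/T_i$ for $j\ne i$ and $\underline V=(V_j)_{j\ne i}$, with values $\underline v=(v_j)_{j\ne i}$, $v_j>0$. Let $e=\frac1p\left(1-\exp\{-\frac{p}{n-k+1}\}\right)$ and define $\phi_{i*}(\underline v)=e$ if $i=1$ and $\phi_{i*}(\underline v)=e\,(1+\sum_{j=1}^{i-1}v_j)$ if $i=2,\dots,k$; $\phi_i^*(\underline v)=e\,(1+\sum_{j=2}^kv_j)$ if $i=1$ and $\phi_i^*(\underline v)=+\infty$ if $i=2,\dots,k$. (These are the infimum and supremum over $\sigma_1\le\cdots\le\sigma_k$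 of $e\,(1+\sum_{j\ne i}v_j\sigma_i/\sigma_j)$.) For a given $\phi_i$, the truncation is $\phi_{i0}(\underline v)=\phi_{i*}(\underline v)$ if $\phi_i(\underline v)\le\phi_{i*}(\underline v)$; $\phi_{i0}(\underline v)=\phi_i(\underline v)$ if $\phi_{i*}(\underline v)<\phi_i(\underline v)<\phi_i^*(\underline v)$; $\phi_{i0}(\underline v)=\phi_i^*(\underline v)$ if $\phi_i(\underline v)\ge\phi_i^*(\underline v)$. The risk of an estimator $\delta$ is $E\,L(\sigma_i,\delta)$; for the estimators here it depends only on $\underline\sigma$. An estimator $\delta'$ dominates $\delta$ if its risk is at most that of $\delta$ for every $\underline\sigma$ with $\sigma_1\le\cdots\le\sigma_k$, with strict inequality for at least one such $\underline\sigma$.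
   Formalization: The formal theorem additionally assumes that the truncated estimator has finite risk at some ordered σ; without this both risks can be +∞ at every σ (e.g. p>0, k=2, i=2, φ(v)=v² for v≥1 and 0 otherwise), so strict inequality fails. *)

(* Defs.v *)
From HB Require Import structures.
From mathcomp Require Import all_boot all_order all_algebra.
From mathcomp Require Import all_classical all_reals all_analysis.

Set Implicit Arguments.
Unset Strict Implicit.
Unset Printing Implicit Defensive.
Import Order.TTheory GRing.Theory Num.Theory.
Local Open Scope classical_set_scope.
Local Open Scope ring_scope.

(* Since some of the B a may be setT, the product rule over the whole finite
   index type contains the product rule over every subfamily. *)
Definition mutually_independent (R : realType) (d : measure_display)
    (Omega : measurableType d) (P : probability Omega R) (I : finType)
    (X : I -> Omega -> R) : Prop :=
  forall B : I -> set R, (forall a, measurable (B a)) ->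
    P (\bigcap_a (X a @^-1` B a)) = (\prod_a P (X a @^-1` B a))%E.

Definition exp_density (R : realType) (mu sigma x : R) : R :=
  if mu < x then sigma^-1 * expR (- (x - mu) / sigma) else 0.

Definition exp_samples (R : realType) (d : measure_display)
    (Omega : measurableType d) (k : nat) (n : 'I_k -> nat)
    (X : forall i : 'I_k, 'I_(n i) -> {mfun Omega >-> R})
    (P : probability Omega R) (mu sigma : 'I_k -> R) : Prop :=
  (forall (i : 'I_k) (j : 'I_(n i)) (A : set R), measurable A ->
     distribution P (X i j) A =
     (\int[lebesgue_measure]_(x in A) (exp_density (mu i) (sigma i) x)%:E)%E) /\
  mutually_independent P
    (fun (a : {i : 'I_k & 'I_(n i)}) w => X (tag a) (tagged a) w).

(* The infimum of a finite nonempty set of reals is its minimum. *)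
Definition sample_min (R : realType) (Omega : Type) (m : nat)
    (X : 'I_m -> Omega -> R) (w : Omega) : R :=
  inf (range (fun j => X j w)).

Definition statT (R : realType) (Omega : Type) (m : nat)
    (X : 'I_m -> Omega -> R) (w : Omega) : R :=
  \sum_(j < m) (X j w - sample_min X w).

(* A family indexed by the j != i is a (k-1)-tuple: its entry at j : 'I_k.-1
   belongs to the index lift i j : 'I_k. *)
Definition ratios (R : realType) (Omega : Type) (k : nat)
    (T : 'I_k -> Omega -> R) (i : 'I_k) (w : Omega) : k.-1.-tuple R :=
  [tuple T (lift i j) w / T i w | j < k.-1].

Definition e_const (R : realType) (p : R) (k : nat) (n : 'I_k -> nat) : R :=
  (1 - expR (- (p / ((\sum_(j < k) n j)%:R - k%:R + 1)))) / p.

(* For i = 0 the sum is empty and the bound is e_const p n. *)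
Definition phi_low (R : realType) (p : R) (k : nat) (n : 'I_k -> nat)
    (i : 'I_k) (v : k.-1.-tuple R) : R :=
  e_const p n * (1 + \sum_(j < k.-1 | (lift i j < i)%N) tnth v j).

Definition phi_up (R : realType) (p : R) (k : nat) (n : 'I_k -> nat)
    (i : 'I_k) (v : k.-1.-tuple R) : \bar R :=
  if val i == 0 then (e_const p n * (1 + \sum_(j < k.-1) tnth v j))%:E
  else +oo%E.

(* [fine] is only reached when phi_up is finite. *)
Definition truncation (R : realType) (p : R) (k : nat) (n : 'I_k -> nat)
    (i : 'I_k) (phi : k.-1.-tuple R -> R) (v : k.-1.-tuple R) : R :=
  if phi v <= phi_low p n i v then phi_low p n i v
  else if ((phi v)%:E < phi_up p n i v)%E then phi v
  else fine (phi_up p n i v).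

Definition estimator (R : realType) (Omega : Type) (k : nat)
    (T : 'I_k -> Omega -> R) (i : 'I_k) (phi : k.-1.-tuple R -> R)
    (w : Omega) : R :=
  T i w * phi (ratios T i w).

Definition linex (R : realType) (p s delta : R) : R :=
  expR (p * (delta / s - 1)) - p * (delta / s - 1) - 1.

(* The linex loss is nonnegative, so the risk is always defined in [0, +oo]. *)
Definition risk (R : realType) (d : measure_display) (Omega : measurableType d)
    (P : probability Omega R) (p s : R) (delta : Omega -> R) : \bar R :=
  ('E_P[fun w => linex p s (delta w)])%E.

Definition positive_scales (R : realType) (k : nat) (sigma : 'I_k -> R) : Prop :=
  forall j, 0 < sigma j.

Definition ordered_scales (R : realType) (k : nat) (sigma : 'I_k -> R) : Prop :=
  positive_scales sigma /\
  forall a b : 'I_k, (a <= b)%N -> sigma a <= sigma b.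

(* [delta'] dominates [delta] as an estimator of sigma_i.  Both the comparison
   and its strict case hold whatever the value of the nuisance location mu. *)
Definition dominates (R : realType) (d : measure_display)
    (Omega : measurableType d) (k : nat)
    (P : ('I_k -> R) -> ('I_k -> R) -> probability Omega R)
    (p : R) (i : 'I_k) (delta' delta : Omega -> R) : Prop :=
  (forall mu sigma, ordered_scales sigma ->
     (risk (P mu sigma) p (sigma i) delta' <=
      risk (P mu sigma) p (sigma i) delta)%E) /\
  exists sigma, ordered_scales sigma /\
    forall mu, (risk (P mu sigma) p (sigma i) delta' <
                risk (P mu sigma) p (sigma i) delta)%E.

(* Main.v *)
Require Import Defs.
From HB Require Import structures.
From mathcomp Require Import all_boot all_order all_algebra.
From mathcomp Require Import all_classical all_reals all_analysis.
From mathcomp Require Import measurable_realfun ring.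

Set Implicit Arguments.
Unset Strict Implicit.
Unset Printing Implicit Defensive.
Import Order.TTheory GRing.Theory Num.Theory.
Import numFieldNormedType.Exports.
Local Open Scope classical_set_scope.
Local Open Scope ring_scope.

(** Let [W j] be the spread of the [j]-th sample, [\sum_l (X j l - min)], divided
    by [sigma j]; the law of the [W j] does not depend on the parameters.  The loss
    of [T i * phi V], for the ratios [V], depends on the sample only through
    [W i * phi V].  With the total [S := \sum_j W j] and the weight
    [b V := 1 + \sum_j V j * (sigma i / sigma j)] one has [W i = S / b V], so that
    the loss is the linex loss of the multiple [c * S] of the total, where
    [c := phi V / b V].

    Given [V], the total has a Gamma law that does not depend on [V], and the
    expected loss of [c * S] is a convex function of [c] with its minimum at
    [e := e_const p n].  The order restriction confines [e * b V] between the two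
    truncation bounds, so truncation moves [c] towards [e] without passing it
    ([truncation_between]).  By convexity of the loss itself, the loss of [phi]
    exceeds the loss of its truncation by a nonnegative gap plus the change of [c]
    times the derivative at [e] of the loss in the multiple of [S]
    ([linex_gap_ge0]).  That derivative has mean zero given [V]
    ([integral_total_tilt]), and therefore the risk of [phi] is the risk of its
    truncation plus the mean of the gap ([risk_gap]).  The gap is positive
    at almost every point where the truncation differs from [phi], and whether
    they differ with positive probability does not depend on the scales
    ([ratios_null_sets]).  So the risk decreases strictly wherever the risk of
    the truncation is finite.

    All that is used of the law of the spreads is that changing the scales
    tilts it exponentially ([spreads_tilt]).  That identity is proved on a
    standard exponential sample, where an affine change of the observations of
    one group has an explicit density ([standard_affine]).  Translations show that
    the minimum of a group is an exponential variable independent of every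
    location-invariant statistic ([group_min_expectation]).  Rescaling a group
    tilts the law by the sum of its observations, which is the spread plus a
    multiple of the minimum, and integrating out the minimum leaves the tilt by
    the spread. *)

(** * Measures with a density *)

Section density_measure.
Local Open Scope ereal_scope.
Context d (T : measurableType d) (R : realType).
Variables (mu : {measure set T -> \bar R}) (f : T -> R).
Hypotheses (f_ge0 : forall x, (0 <= f x)%R) (mf : measurable_fun [set: T] f).

(** The two proofs are arguments so that the measure structure below can be
    inferred from the term alone. *)
Definition density_measure_of (_ : forall x, (0 <= f x)%R)
    (_ : measurable_fun [set: T] f) (A : set T) := \int[mu]_(x in A) (f x)%:E.

Local Notation dens := (density_measure_of f_ge0 mf).

Let dens0 : dens set0 = 0.
Proof. exact: integral_set0. Qed.

Let dens_ge0 A : 0 <= dens A.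
Proof. by apply: integral_ge0 => x _; rewrite lee_fin. Qed.

Let dens_sigma_additive : semi_sigma_additive dens.
Proof.
move=> /= F mF tF mUF; rewrite /density_measure_of; apply: cvg_toP.
  apply: ereal_nondecreasing_is_cvgn => m n mn.
  by apply: lee_sum_nneg_natr => // k _ _; exact: dens_ge0.
rewrite ge0_integral_bigcup//=; last by move=> x _; rewrite lee_fin.
by apply/measurable_EFinP; exact: measurable_funTS.
Qed.

HB.instance Definition _ := isMeasure.Build _ _ _
  dens dens0 dens_ge0 dens_sigma_additive.

Definition density_measure : {measure set T -> \bar R} := dens.

Lemma density_measureE A : density_measure A = \int[mu]_(x in A) (f x)%:E.
Proof. by []. Qed.

Import HBNNSimple.

(** Both sides commute with increasing limits and with finite sums, so the
    definition of the density, which is the case of an indicator, suffices. *)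
Lemma ge0_integral_density (g : T -> \bar R) : (forall x, 0 <= g x) ->
  measurable_fun [set: T] g ->
  \int[density_measure]_x g x = \int[mu]_x (g x * (f x)%:E).
Proof.
move=> g0 mg; pose h := nnsfun_approx measurableT mg.
have hg x : (EFin \o h n) x @[n --> \oo] --> g x.
  by apply: cvg_nnsfun_approx => // y _; exact: g0.
have hnd x : {homo (fun n => (EFin \o h n) x) : m n / (m <= n)%N >-> m <= n}.
  by move=> m n mn; rewrite lee_fin; exact/lefP/nd_nnsfun_approx.
have mh n : measurable_fun [set: T] (EFin \o h n).
  by apply/measurable_EFinP.
have mEf : measurable_fun [set: T] (EFin \o f) by exact/measurable_EFinP.
have -> : \int[density_measure]_x g x =
    limn (fun n => \int[density_measure]_x (EFin \o h n) x).
  rewrite -monotone_convergence//.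
  - by apply: eq_integral => x _; apply/esym/cvg_lim.
  - by move=> n x _; rewrite lee_fin.
have -> : \int[mu]_x (g x * (f x)%:E) =
    limn (fun n => \int[mu]_x ((EFin \o h n) x * (f x)%:E)).
  rewrite -monotone_convergence//.
  - by apply: eq_integral => x _; apply/esym/cvg_lim => //; exact: cvgeZr.
  - by move=> n; exact: emeasurable_funM.
  - by move=> n x _; rewrite mule_ge0 ?lee_fin.
  - by move=> x _ m n mn; rewrite lee_wpmul2r ?lee_fin//; exact: hnd.
congr (limn _); apply/funext => n.
transitivity (\int[density_measure]_x
   (\sum_(y \in range (h n)) (y * \1_(h n @^-1` [set y]) x)%:E)).
  by apply: eq_integral => t tE; rewrite /= fimfunE -fsumEFin.
have mind m r : measurable_fun [set: T]
    (fun x => (r * \1_(h m @^-1` [set r]) x)%:E).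
  by apply/measurable_EFinP/measurable_funM.
rewrite ge0_integral_fsum//; last by move=> m y _; exact: nnfun_muleindic_ge0.
transitivity (\int[mu]_x (\sum_(y \in range (h n))
    (y * \1_(h n @^-1` [set y]) x)%:E * (f x)%:E)); last first.
  apply: eq_integral => x _.
  rewrite -ge0_mule_fsuml => [|y]; last exact: nnfun_muleindic_ge0.
  by rewrite /= [in RHS]fimfunE -fsumEFin.
rewrite ge0_integral_fsum//; last 2 first.
- by move=> y; exact: emeasurable_funM.
- by move=> y x _; rewrite mule_ge0 ?lee_fin//; exact: nnfun_muleindic_ge0.
apply: eq_fsbigr => r rfn.
have r0 : (0 <= r)%R by move: rfn; rewrite inE => -[x _ <-].
under [RHS]eq_integral do rewrite EFinM -muleA.
rewrite integralZl_indic_nnsfun// ge0_integralZl//; last 2 first.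
- by apply: emeasurable_funM => //; exact/measurable_EFinP.
- by move=> x _; rewrite mule_ge0 ?lee_fin.
congr (_ * _).
have mA : measurable (h n @^-1` [set r]).
  by rewrite -[X in measurable X]setTI; exact: measurable_funP.
rewrite integral_indic// setIT density_measureE integral_mkcond.
apply: eq_integral => x _; rewrite patchE indicE.
by case: (x \in _); rewrite ?mul1e ?mul0e.
Qed.

End density_measure.
Arguments density_measure {d T R} mu {f} f_ge0 mf.
Arguments ge0_integral_density {d T R} mu {f} f_ge0 mf g.

(** * Product laws on tuples *)

Lemma measurable_prod_if (R : realType) d (T : measurableType d) (I : finType)
    (P : pred I) (h : I -> T -> R) :
  (forall i, P i -> measurable_fun [set: T] (h i)) ->
  measurable_fun [set: T] (fun x => \prod_(i | P i) h i x).
Proof.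
move=> mh.
have -> : (fun x => \prod_(i | P i) h i x) =
    (fun x => \prod_i (if P i then h i x else 1)).
  by apply/funext => x; rewrite big_mkcond.
apply: measurable_prod => i _; have := mh i.
by case: (P i) => [/(_ isT)//|_]; exact: measurable_cst.
Qed.

Lemma measurable_lt_fun (R : realType) d (U : measurableType d) (f h : U -> R) :
  measurable_fun [set: U] f -> measurable_fun [set: U] h ->
  measurable ([set: U] `&` [set x | (f x < h x)%R]).
Proof.
move=> mf mh; have mt : measurable [set true] by [].
have := measurable_fun_ltr mf mh measurableT mt.
by rewrite (_ : _ @^-1` _ = [set x | (f x < h x)%R]).
Qed.

Lemma measurable_indic_lt (R : realType) (m : R) :
  measurable_fun [set: R] (\1_[set t | (t < m)%R] : R -> R).
Proof.
apply: measurable_indic; rewrite -[X in measurable X]setTI.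
exact: measurable_lt_fun.
Qed.

Section product_laws.
Local Open Scope ereal_scope.
Context (R : realType) (n : nat).
Implicit Types (B : 'I_n -> set R) (nu : 'I_n -> {measure set R -> \bar R}).

Definition rectangle B : set (n.-tuple R) :=
  [set x | forall a, B a (tnth x a)].

Lemma measurable_rectangle B : (forall a, measurable (B a)) ->
  measurable (rectangle B).
Proof.
move=> mB; rewrite (_ : rectangle B =
  \bigcap_(a in [set: 'I_n]) ((fun x => tnth x a) @^-1` B a)); last first.
  by apply/seteqP; split=> [x h a _|x h a]; [exact: h|exact: (h a)].
apply: fin_bigcap_measurable => //.
move=> a _; rewrite -[X in measurable X]setTI.
exact: measurable_tnth.
Qed.

Lemma measure_rectangle_unique (m1 m2 : {measure set (n.-tuple R) -> \bar R}) :
  m1 [set: n.-tuple R] < +oo ->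
  (forall B, (forall a, measurable (B a)) ->
     m1 (rectangle B) = m2 (rectangle B)) ->
  forall A, measurable A -> m1 A = m2 A.
Proof.
move=> m1oo m12 A mA.
pose G : set (set (n.-tuple R)) :=
  [set X | exists2 B, (forall a, measurable (B a)) & X = rectangle B].
have GT : G setT.
  by exists (fun=> setT) => //; apply/seteqP; split.
apply: (measure_unique G (fun=> setT)) => //.
- apply/seteqP; split.
    apply: smallest_sub; first exact: smallest_sigma_algebra.
    rewrite -bigcup_seq => X /= [a _ [C mC <-]].
    apply: sub_sigma_algebra.
    exists (fun b => if b == a then C else setT).
      by move=> b; case: ifP.
    apply/seteqP; split=> [x /= [_ Cx] b|x /= /(_ a)].
      by case: eqP => // ->.
    by rewrite eqxx; split.
  apply: smallest_sub => [|X [B mB ->]].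
    exact: sigma_algebra_measurable.
  exact: measurable_rectangle.
- move=> _ _ [B mB ->] [C mC ->]; exists (fun a => B a `&` C a).
    by move=> a; exact: measurableI.
  apply/seteqP; split=> [x /= [h1 h2] a|x /= h]; first by split.
  by split=> a; have [] := h a.
- by rewrite bigcup_const//; exists 0%N.
- by move=> _ [B mB ->]; exact: m12.
Qed.

Definition product_law (Q : set (n.-tuple R) -> \bar R)
    (nu : 'I_n -> set R -> \bar R) :=
  forall B, (forall a, measurable (B a)) ->
    Q (rectangle B) = \prod_a nu a (B a).

(** Independence in the form needed here: an integral of a product of
    functions of the separate coordinates factors. *)
Lemma product_law_expectation (Q : {measure set (n.-tuple R) -> \bar R}) nu
    (f : 'I_n -> R -> R) :
  product_law Q nu -> (forall a, nu a setT < +oo) ->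
  (forall a x, (0 <= f a x)%R) ->
  (forall a, measurable_fun [set: R] (f a)) ->
  (forall a, \int[nu a]_x (f a x)%:E < +oo) ->
  \int[Q]_x (\prod_a f a (tnth x a))%:E = \prod_a \int[nu a]_x (f a x)%:E.
Proof.
move=> Qnu nuoo f0 mf foo.
pose I a := \int[nu a]_x (f a x)%:E.
have I0 a : 0 <= I a by apply: integral_ge0 => x _; rewrite lee_fin.
(* One coordinate at a time, an indicator is replaced by [f a].  With the
   other factors fixed, both sides are integrals of [f a0] with respect to
   measures on the line that agree on every Borel set. *)
suff main s : uniq s -> forall B, (forall a, measurable (B a)) ->
    \int[Q]_x (\prod_a (if a \in s then f a (tnth x a)
                        else \1_(B a) (tnth x a)))%:E =
    \prod_a (if a \in s then I a else nu a (B a)).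
  have := main _ (enum_uniq 'I_n) (fun=> setT) (fun=> measurableT).
  under eq_integral do under eq_bigr do rewrite mem_enum.
  by under [in RHS]eq_bigr do rewrite mem_enum.
elim: s => [_ B mB|a0 s IH /= /andP[a0s us] B mB].
  rewrite [RHS](eq_bigr (fun a => nu a (B a)))//.
  rewrite -Qnu// -[rectangle B]setIT -integral_indic//; last first.
    exact: measurable_rectangle.
  apply: eq_integral => x _; congr EFin.
  rewrite (eq_bigr (fun a => \1_(B a) (tnth x a)))//.
  rewrite indicE; case: (asboolP (rectangle B x)) => [h|/existsNP[a ha]].
    by rewrite mem_set//= big1// => a _; rewrite indicE mem_set.
  rewrite memNset; last by move=> /(_ a).
  by rewrite (bigD1 a)//= indicE memNset// mul0r.
pose h x := (\prod_(a | a != a0) (if a \in s then f a (tnth x a)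
                        else \1_(B a) (tnth x a)))%R.
pose K := \prod_(a | a != a0) (if a \in s then I a else nu a (B a)).
have nufin a : nu a (B a) < +oo.
  by apply: le_lt_trans (nuoo a); rewrite le_measure ?inE.
have Kfin : K \is a fin_num.
  apply: prode_fin_num => a _; case: ifP => _; rewrite ge0_fin_numE//.
  exact: foo.
have K0 : 0 <= K by apply: prode_ge0 => a _; case: ifP.
have h0 x : (0 <= h x)%R by apply: prodr_ge0 => a _; case: ifP.
have mtn a : measurable_fun [set: n.-tuple R] (fun x => tnth x a).
  exact: measurable_tnth.
have mh : measurable_fun [set: n.-tuple R] h.
  apply: measurable_prod_if => a _; case: (a \in s).
    exact: (measurableT_comp (mf a)).
  exact: (measurableT_comp (measurable_indic (mB a)) (mtn a)).
have Ka x : (0 <= (cst (fine K) : R -> R) x)%R by exact: fine_ge0.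
have prodE (F : 'I_n -> \bar R) c : \prod_a (if a == a0 then c else F a) =
    c * \prod_(a | a != a0) F a.
  rewrite (bigD1 a0)//= eqxx; congr (_ * _).
  by apply: eq_bigr => a /negbTE ->.
pose m1 := density_measure Q h0 mh.
pose m2 := density_measure (nu a0) Ka (measurable_cst _).
have m12 C : measurable C -> pushforward m1 (fun x => tnth x a0) C = m2 C.
  move=> mC; pose BC a := if a == a0 then C else B a.
  have mBC a : measurable (BC a) by rewrite /BC; case: ifP.
  have -> : m2 C = nu a0 C * K.
    rewrite density_measureE (integral_cst _ mC (fine K)%:E) fineK//.
    exact: muleC.
  transitivity (\prod_a (if a \in s then I a else nu a (BC a))); last first.
    rewrite (bigD1 a0)//= (negbTE a0s) /BC eqxx; congr (_ * _).
    by apply: eq_bigr => a /negbTE ->.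
  rewrite -IH// /pushforward [LHS]integral_mkcond; apply: eq_integral => x _.
  rewrite patchE (bigD1 a0)//= (negbTE a0s) /BC eqxx.
  have -> : (\prod_(a < n | a != a0) (if a \in s then f a (tnth x a)
      else \1_(if a == a0 then C else B a) (tnth x a)))%R = h x.
    by apply: eq_bigr => a /negbTE ->.
  rewrite indicE; case: (asboolP (C (tnth x a0))) => Cx.
    by rewrite !mem_set// mul1r.
  by rewrite !memNset// mul0r.
have -> : \prod_a (if a \in a0 :: s then I a else nu a (B a)) = I a0 * K.
  rewrite (bigD1 a0)//= inE eqxx; congr (_ * _).
  by apply: eq_bigr => a aa0; rewrite inE (negbTE aa0).
transitivity (\int[Q]_x ((f a0 (tnth x a0))%:E * (h x)%:E)).
  apply: eq_integral => x _; rewrite (bigD1 a0)//= inE eqxx -EFinM.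
  congr (_ * _)%:E.
  by apply: eq_bigr => a aa0; rewrite inE (negbTE aa0).
have mEf a : measurable_fun [set: R] (EFin \o f a) by exact/measurable_EFinP.
rewrite -(ge0_integral_density Q h0 mh (fun x => (f a0 (tnth x a0))%:E)); last 2 first.
- by move=> x; rewrite lee_fin.
- exact: (measurableT_comp (mEf a0)).
transitivity (\int[pushforward m1 (fun x => tnth x a0)]_y (f a0 y)%:E).
  rewrite ge0_integral_pushforward//; first exact: mEf.
  by move=> y _; rewrite lee_fin.
rewrite (eq_measure_integral m2) => [|A mA _]; last exact: m12.
rewrite ge0_integral_density//; last 2 first.
- by move=> y; rewrite lee_fin.
- exact: mEf.
under eq_integral do rewrite /= fineK//.
rewrite ge0_integralZr//; first exact: mEf.
by move=> y _; rewrite lee_fin.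
Qed.

(** If each marginal changes by a density [r a], then the product law changes
    by the product of these densities: on a rectangle this is the
    factorization above, and rectangles determine a finite measure. *)
Lemma product_law_change_density (Q Q' : {measure set (n.-tuple R) -> \bar R})
    nu nu' (r : 'I_n -> R -> R) (F : n.-tuple R -> \bar R) :
  product_law Q nu -> product_law Q' nu' ->
  (forall a, nu a setT < +oo) -> (forall a, nu' a setT < +oo) ->
  (forall a x, (0 <= r a x)%R) -> (forall a, measurable_fun [set: R] (r a)) ->
  (forall a A, measurable A -> nu' a A = \int[nu a]_(x in A) (r a x)%:E) ->
  (forall x, 0 <= F x) -> measurable_fun [set: n.-tuple R] F ->
  \int[Q']_x F x = \int[Q]_x (F x * (\prod_a r a (tnth x a))%:E).
Proof.
move=> Qnu Qnu' nuoo nuoo' r0 mr nur F0 mF.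
have mtn a : measurable_fun [set: n.-tuple R] (fun x => tnth x a).
  exact: measurable_tnth.
have h0 (x : n.-tuple R) : (0 <= \prod_a r a (tnth x a))%R by exact: prodr_ge0.
have mh : measurable_fun [set: n.-tuple R]
    (fun x : n.-tuple R => \prod_a r a (tnth x a))%R.
  by apply: measurable_prod_if => a _; exact: (measurableT_comp (mr a)).
rewrite -(ge0_integral_density Q h0 mh)//.
apply: eq_measure_integral => A mA _; apply: measure_rectangle_unique mA.
  have -> : [set: n.-tuple R] = rectangle (fun=> setT) by apply/seteqP; split.
  rewrite Qnu'// ltey_eq prode_fin_num// => a _.
  by rewrite ge0_fin_numE.
move=> B mB; rewrite Qnu'// density_measureE.
have mind a : measurable_fun [set: R] (fun x => r a x * \1_(B a) x)%R.
  by apply: measurable_funM => //; exact: measurable_indic.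
have nuB a : \int[nu a]_x (r a x * \1_(B a) x)%:E = nu' a (B a).
  rewrite nur// [RHS]integral_mkcond; apply: eq_integral => x _.
  by rewrite patchE indicE; case: (x \in B a); rewrite ?mulr1 ?mulr0.
under eq_bigr do rewrite -nuB.
rewrite -(product_law_expectation Qnu)//.
- rewrite [RHS]integral_mkcond; apply: eq_integral => x _.
  rewrite patchE; case: (asboolP (rectangle B x)) => [h|/existsNP[a ha]].
    rewrite mem_set//; congr EFin; apply: eq_bigr => a _.
    by rewrite indicE mem_set ?mulr1.
  rewrite memNset; last by move=> /(_ a).
  by rewrite (bigD1 a)//= indicE memNset// mulr0 mul0r.
- by move=> a x; rewrite mulr_ge0.
- move=> a; rewrite nuB; apply: le_lt_trans (nuoo' a).
  by rewrite le_measure ?inE.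
Qed.

Definition tuple_map (psi : 'I_n -> R -> R) (x : n.-tuple R) : n.-tuple R :=
  [tuple psi a (tnth x a) | a < n].

Lemma measurable_tuple_map psi : (forall a, measurable_fun [set: R] (psi a)) ->
  measurable_fun [set: n.-tuple R] (tuple_map psi).
Proof.
move=> mpsi; apply/measurable_fun_tnthP => a.
rewrite (_ : _ \o _ = psi a \o (fun x => tnth x a)).
  by apply: measurableT_comp => //; exact: measurable_tnth.
by apply/funext => x /=; rewrite tnth_mktuple.
Qed.

Lemma product_law_pushforward (Q : {measure set (n.-tuple R) -> \bar R}) nu
    (psi : 'I_n -> R -> R) :
  product_law Q nu -> (forall a, measurable_fun [set: R] (psi a)) ->
  product_law (pushforward Q (tuple_map psi))
    (fun a => pushforward (nu a) (psi a)).
Proof.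
move=> Qnu mpsi B mB.
transitivity (Q (rectangle (fun a => psi a @^-1` B a))).
  congr (Q _); apply/seteqP; split=> x h a; have := h a;
    by rewrite /tuple_map tnth_mktuple.
by apply: Qnu => a; rewrite -[X in measurable X]setTI; exact: mpsi.
Qed.

Lemma product_law_unique (Q Q' : {measure set (n.-tuple R) -> \bar R}) nu :
  product_law Q nu -> product_law Q' nu -> (forall a, nu a setT < +oo) ->
  forall A, measurable A -> Q A = Q' A.
Proof.
move=> Qnu Qnu' nuoo; apply: measure_rectangle_unique => [|B mB].
  have -> : [set: n.-tuple R] = rectangle (fun=> setT) by apply/seteqP; split.
  rewrite Qnu// ltey_eq prode_fin_num// => a _.
  by rewrite ge0_fin_numE.
by rewrite Qnu// Qnu'.
Qed.

End product_laws.

(** * Exponential laws on the line *)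

Section affine_lebesgue.
Local Open Scope ereal_scope.
Context (R : realType).
Local Notation mu := (@lebesgue_measure R).

Lemma ge0_integral_lebesgue_affine (b s : R) (G : R -> \bar R) : (0 < s)%R ->
  (forall x, 0 <= G x) -> measurable_fun [set: R] G ->
  \int[mu]_x G x = s%:E * \int[mu]_x G (b + s * x)%R.
Proof.
move=> s0 G0 mG.
pose psi : measurableTypeR R -> measurableTypeR R := fun x => (b + s * x)%R.
have mpsi : measurable_fun [set: measurableTypeR R] psi.
  by apply: measurable_funD => //; exact: measurable_funM.
pose m' : {measure set (measurableTypeR R) -> \bar R} :=
  mscale (NngNum (ltW s0)) (pushforward mu psi).
pose m := m' mpsi.
transitivity (\int[m]_x G x).
  apply: eq_measure_integral => A mA _.
  apply: lebesgue_measure_unique => // _ [[x y] _ <-].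
  have psiE : psi @^-1` `]x, y] = [set` `]((x - b) / s)%R, ((y - b) / s)%R]%R].
    apply/seteqP; split=> z /=; rewrite !in_itv/= ltr_pdivrMr// ler_pdivlMr//;
      by rewrite /psi ltrBlDl lerBrDl (mulrC z).
  change (mu `]x, y] = s%:E * mu (psi @^-1` `]x, y])).
  rewrite psiE !lebesgue_measure_itv/= !lte_fin ltr_pM2r ?invr_gt0// ltrD2r.
  case: ifP => _; last by rewrite mule0.
  by rewrite -!EFinD -EFinM; congr EFin; field; rewrite gt_eqF.
rewrite ge0_integral_mscale//; congr (_ * _).
by rewrite ge0_integral_pushforward.
Qed.

End affine_lebesgue.

Section exponential_law.
Context (R : realType).
Local Notation mu := (@lebesgue_measure R).

Lemma exp_density_ge0 (b s : R) : 0 < s -> forall x, 0 <= exp_density b s x.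
Proof.
by move=> s0 x; rewrite /exp_density; case: ifP => // _;
  rewrite mulr_ge0 ?expR_ge0// invr_ge0 ltW.
Qed.

Lemma measurable_tail_if (b : R) (h : R -> R) : measurable_fun [set: R] h ->
  measurable_fun [set: R] (fun x => if b < x then h x else 0).
Proof.
move=> mh; apply: measurable_fun_ifT => //.
by apply: measurable_fun_ltr.
Qed.

Lemma measurable_exp_density (b s : R) :
  measurable_fun [set: R] (exp_density b s).
Proof.
apply: measurable_tail_if; apply: measurable_funM => //.
apply: measurableT_comp => //; apply: measurable_funM => //.
by apply: measurableT_comp => //; exact: measurable_funB.
Qed.

(** Lebesgue measure on the Borel structure that [R] carries by default, which
    is the one of the tuples and of the random variables; [lebesgue_measure]
    itself is a measure on the copy [measurableTypeR R]. *)
Definition lebesgueR : set R -> \bar R :=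
  pushforward mu (idfun : measurableTypeR R -> R).

Let lebesgueR0 : lebesgueR set0 = 0%E.
Proof. exact: (measure0 mu). Qed.

Let lebesgueR_ge0 A : (0 <= lebesgueR A)%E.
Proof. exact: (measure_ge0 mu). Qed.

Let lebesgueR_sigma_additive : semi_sigma_additive lebesgueR.
Proof. exact: (@measure_semi_sigma_additive _ _ _ mu). Qed.

HB.instance Definition _ := isMeasure.Build _ _ _
  lebesgueR lebesgueR0 lebesgueR_ge0 lebesgueR_sigma_additive.

HB.instance Definition _ := @Measure_isSigmaFinite.Build _ _ _
  lebesgueR (sigma_finiteT mu).

Lemma ge0_integral_lebesgueR (A : set R) (f : R -> \bar R) : measurable A ->
  measurable_fun [set: R] f -> (forall x, 0 <= f x)%E ->
  (\int[lebesgueR]_(x in A) f x = \int[mu]_(x in A) f x)%E.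
Proof.
move=> mA mf f0; rewrite ge0_integral_pushforward//; last exact: measurable_funTS.
by move=> _ B mB; rewrite setTI.
Qed.

Definition exp_law (b s : R) (s0 : 0 < s) : {measure set R -> \bar R} :=
  density_measure lebesgueR (@exp_density_ge0 b s s0)
    (measurable_exp_density b s).

Lemma measurable_EFin_exp_density (b s : R) :
  measurable_fun [set: R] (EFin \o exp_density b s).
Proof. by apply/measurable_EFinP; exact: measurable_exp_density. Qed.

Lemma exp_lawE (b s : R) (s0 : 0 < s) (A : set R) : measurable A ->
  exp_law b s0 A = (\int[mu]_(x in A) (exp_density b s x)%:E)%E.
Proof.
move=> mA; rewrite -ge0_integral_lebesgueR//.
  exact: measurable_EFin_exp_density.
by move=> x; rewrite lee_fin exp_density_ge0.
Qed.

Lemma exp_law_affine (b s : R) (s0 : 0 < s) (A : set R) : measurable A ->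
  exp_law b s0 A = exp_law 0 ltr01 ((fun x => b + s * x) @^-1` A).
Proof.
move=> mA.
have mpsi : measurable_fun [set: R] (fun x => b + s * x).
  by apply: measurable_funD => //; exact: measurable_funM.
have mpA : measurable ((fun x => b + s * x) @^-1` A).
  by rewrite -[X in measurable X]setTI; exact: mpsi.
rewrite !exp_lawE// [LHS]integral_mkcond [RHS]integral_mkcond.
have mdA b' s' B : measurable B ->
    measurable_fun [set: R] ((fun x => (exp_density b' s' x)%:E) \_ B).
  move=> mB; apply/(measurable_restrictT _ _).1 => //.
  by apply: measurable_funTS; exact: measurable_EFin_exp_density.
have dA0 (b' s' : R) (B : set R) (x : R) : 0 < s' ->
    (0 <= ((fun x => (exp_density b' s' x)%:E) \_ B) x)%E.
  by move=> s'0; apply: erestrict_ge0 => y _; rewrite lee_fin exp_density_ge0.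
rewrite [LHS](@ge0_integral_lebesgue_affine _ b s)//; last 2 first.
- by move=> x; exact: dA0.
- exact: mdA.
rewrite -ge0_integralZl//; last 3 first.
- apply: (@measurableT_comp _ _ _ _ _ _ _ _
      (fun x : measurableTypeR R => b + s * x : measurableTypeR R)).
    exact: mdA.
  exact: mpsi.
- by move=> x _; exact: dA0.
- by rewrite lee_fin ltW.
apply: eq_integral => x _; rewrite !patchE.
have -> : (x \in (fun x => b + s * x) @^-1` A) = (b + s * x \in A).
  by apply/idP/idP; rewrite !inE.
case: ifP => _; last by rewrite mule0.
rewrite -EFinM; congr EFin; rewrite /exp_density.
rewrite ltrDl pmulr_rgt0//; case: ifP => _; last by rewrite mulr0.
rewrite mulrA mulfV ?gt_eqF// mul1r invr1 mul1r; congr expR.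
by field; rewrite gt_eqF.
Qed.

Lemma exp_law_total : exp_law 0 ltr01 setT = 1%E.
Proof.
rewrite exp_lawE// -[RHS](integral_exponential_pdf (@ltr01 R)).
have mpdf : measurable_fun [set: R] (EFin \o exponential_pdf (1 : R)).
  by apply/measurable_EFinP; exact: measurable_exponential_pdf.
rewrite -[LHS](@integral_setD1 _ _ 0); last 2 first.
- exact: measurableD.
- by apply: measurable_funTS; exact: measurable_EFin_exp_density.
rewrite -[RHS](@integral_setD1 _ _ 0); last 2 first.
- exact: measurableD.
- exact: measurable_funTS.
apply: eq_integral => x; rewrite inE => -[_ /= /eqP x0]; congr EFin.
rewrite /exp_density; case: ltrgt0P x0 => // x0 _.
  rewrite exponential_pdfE ?ltW// subr0 invr1 mulr1 mul1r.
  by rewrite mulN1r mul1r.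
by rewrite lt0_exponential_pdf.
Qed.

End exponential_law.

(** * Location and scale changes of a standard exponential sample *)

Section standard_sample.
Local Open Scope ereal_scope.
Context (R : realType) (N : nat).
Variable q : {measure set (N.-tuple R) -> \bar R}.
Hypothesis q_law : product_law q (fun=> exp_law 0 (@ltr01 R)).

(** The density, with respect to the standard exponential law, of the
    exponential law with location [b >= 0] and scale [s]. *)
Definition affine_ratio (b s x : R) : R :=
  if (b < x)%R then (s^-1 * expR (x - (x - b) / s))%R else 0%R.

Lemma affine_ratio_ge0 (b s x : R) : (0 < s)%R -> (0 <= affine_ratio b s x)%R.
Proof.
move=> s0; rewrite /affine_ratio; case: ifP => // _.
by rewrite mulr_ge0 ?expR_ge0// invr_ge0 ltW.
Qed.

Lemma measurable_affine_ratio (b s : R) :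
  measurable_fun [set: R] (affine_ratio b s).
Proof.
apply: measurable_tail_if; apply: measurable_funM => //.
apply: measurableT_comp => //; apply: measurable_funB => //.
by apply: measurable_funM => //; exact: measurable_funB.
Qed.

(** The affine image of a standard sample is again an exponential sample, and
    for nonnegative locations its law has a density with respect to the
    standard one.  Equating both descriptions gives all the identities about
    exponential laws that are used below. *)
Lemma standard_affine (b s : 'I_N -> R) (F : N.-tuple R -> \bar R) :
  (forall a, (0 <= b a)%R) -> (forall a, (0 < s a)%R) ->
  (forall x, 0 <= F x) -> measurable_fun [set: N.-tuple R] F ->
  \int[q]_x F (tuple_map (fun a y => b a + s a * y)%R x) =
  \int[q]_x (F x * (\prod_a affine_ratio (b a) (s a) (tnth x a))%:E).
Proof.
move=> b0 s0 F0 mF.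
have mpsi a : measurable_fun [set: R] (fun y => b a + s a * y)%R.
  by apply: measurable_funD => //; exact: measurable_funM.
have mPsi := measurable_tuple_map mpsi.
pose Q' : {measure set (N.-tuple R) -> \bar R} :=
  pushforward q (tuple_map (fun a y => b a + s a * y)%R).
have Q'law : product_law (Q' mPsi) (fun a => exp_law (b a) (s0 a)).
  move=> B mB; rewrite [LHS](product_law_pushforward q_law mpsi mB).
  by apply: eq_bigr => a _; rewrite exp_law_affine.
have law1 : exp_law 0 (@ltr01 R) setT < +oo by rewrite exp_law_total ltry.
transitivity (\int[pushforward q (tuple_map (fun a y => b a + s a * y)%R)]_x F x).
  by rewrite [RHS]ge0_integral_pushforward.
apply: (product_law_change_density (r := fun a => affine_ratio (b a) (s a))
  q_law Q'law) => //.
- by move=> a; rewrite exp_law_affine// preimage_setT.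
- by move=> a x; exact: affine_ratio_ge0.
- by move=> a; exact: measurable_affine_ratio.
move=> a A mA; rewrite [RHS]integral_mkcond.
have mr : measurable_fun [set: R]
    ((fun x => (affine_ratio (b a) (s a) x)%:E) \_ A).
  apply/(measurable_restrictT _ _).1 => //; apply: measurable_funTS.
  by apply/measurable_EFinP; exact: measurable_affine_ratio.
rewrite ge0_integral_density//; last first.
  by move=> x; apply: erestrict_ge0 => y _; rewrite lee_fin affine_ratio_ge0.
rewrite ge0_integral_lebesgueR//; last 2 first.
- by apply: emeasurable_funM => //; exact: measurable_EFin_exp_density.
- move=> x; apply: mule_ge0; last by rewrite lee_fin exp_density_ge0.
  by apply: erestrict_ge0 => y _; rewrite lee_fin affine_ratio_ge0.
rewrite exp_lawE// integral_mkcond; apply: eq_integral => x _.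
rewrite !patchE; case: ifP => _; last by rewrite mul0e.
rewrite -EFinM; congr EFin; rewrite /exp_density /affine_ratio.
case: ifP => [bx|_]; last by rewrite mul0r.
rewrite (le_lt_trans (b0 a) bx) invr1 mul1r mulr1 -mulrA -expRD.
by congr (_ * expR _)%R; rewrite subr0; ring.
Qed.

End standard_sample.

(** * Group minima and spreads *)

Section groups.
Context (R : realType) (N k : nat) (g : 'I_N -> 'I_k).
Hypothesis g_surj : forall j, exists a, g a = j.
Implicit Types (x : N.-tuple R) (j : 'I_k).

Definition group_size j : nat := #|[pred a | g a == j]|.

(** Written as an infimum to match [sample_min]. *)
Definition group_min j x : R :=
  inf [set tnth x a | a in [set a | g a = j]].

Definition group_spread j x : R :=
  \sum_(a | g a == j) (tnth x a - group_min j x).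

Definition group_affine (b s : 'I_k -> R) x : N.-tuple R :=
  tuple_map (fun a y => b (g a) + s (g a) * y) x.

Lemma group_minP j x : exists2 a, g a = j & group_min j x = tnth x a /\
  forall a', g a' = j -> tnth x a <= tnth x a'.
Proof.
have [a0 /eqP ga0] := g_surj j.
pose a := [arg min_(a < a0 | g a == j) tnth x a]%O.
have [ga amin] : g a = j /\ forall a', g a' = j -> tnth x a <= tnth x a'.
  rewrite /a; case: arg_minP => // c /eqP gc cmin; split=> // a' /eqP ga'.
  exact: cmin.
exists a => //; split=> //; apply/eqP; rewrite eq_le; apply/andP; split.
  apply: ge_inf; last by exists a.
  by exists (tnth x a) => _ [a' /amin h <-].
apply: lb_le_inf; first by exists (tnth x a); exists a.
by move=> _ [a' /amin h <-].
Qed.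

Lemma group_min_le j x a : g a = j -> group_min j x <= tnth x a.
Proof. by move=> ga; have [a' _ [-> ]] := group_minP j x; exact. Qed.

Lemma lt_group_minP j x t :
  t < group_min j x <-> (forall a, g a = j -> t < tnth x a).
Proof.
split=> [tm a ga|h]; first exact: lt_le_trans tm (group_min_le x ga).
by have [a ga [-> _]] := group_minP j x; exact: h.
Qed.

Lemma group_min_affine b s j x : (forall j, 0 < s j) ->
  group_min j (group_affine b s x) = b j + s j * group_min j x.
Proof.
move=> s0; have [a ga [-> amin]] := group_minP j (group_affine b s x).
have [c gc [-> cmin]] := group_minP j x.
apply/eqP; rewrite eq_le; apply/andP; split.
  by have := amin _ gc; rewrite !tnth_mktuple gc ga.
by rewrite tnth_mktuple ga lerD2l ler_pM2l//; exact: cmin.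
Qed.

Lemma group_spread_affine b s j x : (forall j, 0 < s j) ->
  group_spread j (group_affine b s x) = s j * group_spread j x.
Proof.
move=> s0; rewrite /group_spread mulr_sumr; apply: eq_bigr => a /eqP ga.
rewrite group_min_affine// tnth_mktuple ga; ring.
Qed.

Lemma group_spread_ge0 j x : 0 <= group_spread j x.
Proof.
by apply: sumr_ge0 => a /eqP ga; rewrite subr_ge0 group_min_le.
Qed.

Lemma group_sum_spread j x :
  \sum_(a | g a == j) tnth x a =
  group_spread j x + (group_size j)%:R * group_min j x.
Proof.
by rewrite /group_spread sumrB sumr_const mulr_natl subrK.
Qed.

Lemma measurable_group_min j : measurable_fun [set: N.-tuple R] (group_min j).
Proof.
apply: (measurability _ (RGenOInfty.measurableE R)).
move=> _ [_ [t ->] <-]; rewrite setTI.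
rewrite (_ : _ @^-1` _ =
  rectangle (fun a => if g a == j then `]t, +oo[%classic else setT)).
  by apply: measurable_rectangle => a; case: ifP.
apply/seteqP; split=> x /=; rewrite in_itv/= andbT.
  move=> /lt_group_minP h a; case: eqP => // /h.
  by rewrite /= in_itv/= andbT.
move=> h; apply/lt_group_minP => a ga; have := h a.
by rewrite ga eqxx /= in_itv/= andbT.
Qed.

Lemma measurable_group_spread j :
  measurable_fun [set: N.-tuple R] (group_spread j).
Proof.
have -> : group_spread j =
    (fun x => \sum_a (if g a == j then tnth x a - group_min j x else 0)).
  by apply/funext => x; rewrite /group_spread big_mkcond.
apply: measurable_sum => a; case: (g a == j); last exact: measurable_cst.
by apply: measurable_funB; [exact: measurable_tnth|exact: measurable_group_min].
Qed.

Lemma measurable_group_affine b s :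
  measurable_fun [set: N.-tuple R] (group_affine b s).
Proof.
apply: measurable_tuple_map => a.
by apply: measurable_funD => //; exact: measurable_funM.
Qed.

End groups.

(** * Exponential tilting of the group spreads *)

Section standard_groups.
Local Open Scope ereal_scope.
Context (R : realType) (N k : nat) (g : 'I_N -> 'I_k).
Hypothesis g_surj : forall j, exists a, g a = j.
Variable q : probability (N.-tuple R) R.
Hypothesis q_law : product_law q (fun=> exp_law 0 (@ltr01 R)).

Local Notation n := (group_size g).
Local Notation M := (@group_min R N k g).
Local Notation T := (@group_spread R N k g).

Let mM j := measurable_group_min (R := R) g_surj j.
Let mT j := measurable_group_spread (R := R) g_surj j.

Definition positive_orthant : set (N.-tuple R) :=
  rectangle (fun=> `]0%R, +oo[%classic).

Local Notation pos := positive_orthant.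

Lemma measurable_positive_orthant : measurable pos.
Proof. exact: measurable_rectangle. Qed.

Lemma positive_orthantP x : pos x <-> forall a, (0 < tnth x a)%R.
Proof.
by split=> h a; have := h a; rewrite /= in_itv/= andbT.
Qed.

Lemma prod_affine_ratio (b s : 'I_N -> R) (x : N.-tuple R) :
  (\prod_a affine_ratio (b a) (s a) (tnth x a) =
   \1_(rectangle (fun a => `]b a, +oo[%classic)) x *
   \prod_a ((s a)^-1 * expR (tnth x a - (tnth x a - b a) / s a)))%R.
Proof.
rewrite indicE.
case: (asboolP (rectangle (fun a => `]b a, +oo[%classic) x)).
  move=> h; rewrite mem_set// mul1r; apply: eq_bigr => a _.
  by have := h a; rewrite /= in_itv/= andbT /affine_ratio => ->.
move=> h; rewrite memNset// mul0r; move/existsNP : h => [a].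
rewrite /= in_itv/= andbT => /negP ba.
by rewrite (bigD1 a)//= /affine_ratio (negbTE ba) mul0r.
Qed.

Lemma integral_positive_orthant (F : N.-tuple R -> \bar R) :
  (forall x, 0 <= F x) -> measurable_fun [set: N.-tuple R] F ->
  \int[q]_x F x = \int[q]_x (F x * (\1_pos x)%:E).
Proof.
move=> F0 mF.
have := @standard_affine _ _ q q_law (fun=> 0%R) (fun=> 1%R) F
  (fun=> lexx _) (fun=> ltr01) F0 mF.
rewrite (_ : (fun x => F (tuple_map _ x)) = F); last first.
  apply/funext => x; congr F; apply: eq_from_tnth => a.
  by rewrite tnth_mktuple add0r mul1r.
move=> ->; apply: eq_integral => x _; congr (_ * _%:E).
rewrite prod_affine_ratio big1 ?mulr1// => a _.
by rewrite invr1 mul1r mulr1 subr0 subrr expR0.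
Qed.

(** Moving group [j] by [t] does not change a location-invariant [F], while it
    conditions the law on the minimum of the group exceeding [t]: this is the
    lack of memory of exponential laws. *)
Lemma group_min_tail j (t : R) (F : N.-tuple R -> \bar R) : (0 <= t)%R ->
  (forall x, 0 <= F x) -> measurable_fun [set: N.-tuple R] F ->
  (forall b x, F (group_affine g b (fun=> 1%R) x) = F x) ->
  \int[q]_x (F x * (\1_[set x | (t < M j x)%R] x)%:E) =
  (expR (- ((n j)%:R * t)))%:E * \int[q]_x F x.
Proof.
move=> t0 F0 mF Finv.
pose b (j' : 'I_k) : R := if j' == j then t else 0%R.
have b0 j' : (0 <= b j')%R by rewrite /b; case: ifP.
have := @standard_affine _ _ q q_law (fun a => b (g a)) (fun=> 1%R) F
  (fun a => b0 _) (fun=> ltr01) F0 mF.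
under eq_integral do rewrite -/(group_affine g b (fun=> 1%R) _) Finv.
move=> FE.
have mind : measurable_fun [set: N.-tuple R]
    (fun x => (\1_[set x | (t < M j x)%R] x)%:E : \bar R).
  apply/measurable_EFinP; apply: measurable_indic.
  rewrite (_ : mkset _ = M j @^-1` `]t, +oo[%classic).
    by rewrite -[X in measurable X]setTI; exact: mM.
  by apply/seteqP; split => x /=; rewrite in_itv/= andbT.
rewrite (integral_positive_orthant (F := fun x => _ * _)); last 2 first.
- by move=> x; rewrite mule_ge0// lee_fin.
- exact: emeasurable_funM.
rewrite FE -ge0_integralZl//; last 2 first.
- apply: emeasurable_funM => //; apply/measurable_EFinP.
  apply: measurable_prod_if => a _; apply: measurableT_comp.
    exact: measurable_affine_ratio.
  exact: measurable_tnth.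
- move=> x _; rewrite mule_ge0// lee_fin prodr_ge0// => a _.
  exact: affine_ratio_ge0.
apply: eq_integral => x _; rewrite -muleA [RHS]muleCA; congr (_ * _).
rewrite -!EFinM; congr EFin; rewrite prod_affine_ratio.
have -> : (\prod_a (1^-1 * expR (tnth x a - (tnth x a - b (g a)) / 1)) =
    expR ((n j)%:R * t) :> R)%R.
  rewrite (eq_bigr (fun a => if g a == j then expR t else 1%R)) => [|a _].
    rewrite -big_mkcond/= prodr_const -expRM_natl.
    by congr expR; rewrite mulr_natl.
  by rewrite /b invr1 mul1r mulr1 opprB addrC subrK; case: ifP; rewrite ?expR0.
rewrite [RHS]mulrCA -expRD addNr expR0 mulr1.
have -> : rectangle (fun a => `]b (g a), +oo[%classic) =
    [set x | (t < M j x)%R] `&` pos.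
  apply/seteqP; split=> y /=; last first.
    move=> [/(lt_group_minP g_surj) h /positive_orthantP p] a.
    by rewrite /= in_itv/= andbT /b; case: eqP => // /h.
  move=> h; have {}h a : (b (g a) < tnth y a)%R.
    by have := h a; rewrite /= in_itv/= andbT.
  split; last by apply/positive_orthantP => a; exact: le_lt_trans (h a).
  apply/(lt_group_minP g_surj) => a ga.
  by have := h a; rewrite /b ga eqxx.
by rewrite indicI.
Qed.

(** For a location-invariant [F] the minimum of a group behaves like an
    exponential variable of rate [n j] independent of [F].  Writing
    [expR (b * M)] as one plus the integral of its derivative reduces this to
    the tail probabilities above. *)
Lemma group_min_expectation j (b : R) (F : N.-tuple R -> \bar R) :
  (0 <= b < (n j)%:R)%R ->
  (forall x, 0 <= F x) -> measurable_fun [set: N.-tuple R] F ->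
  (forall c x, F (group_affine g c (fun=> 1%R) x) = F x) ->
  \int[q]_x (F x * (expR (b * M j x))%:E) =
  ((n j)%:R / ((n j)%:R - b))%:E * \int[q]_x F x.
Proof.
move=> /andP[b0 bn] F0 mF Finv.
(* [kb t] is [b * expR (b * t)] for [t >= 0] and zero elsewhere, that is minus
   the exponential density with the rate [- b]. *)
pose kb (t : R) : R := (- exponential_pdf (- b) t)%R.
have mkb : measurable_fun [set: R] kb.
  by apply: measurableT_comp => //; exact: measurable_exponential_pdf.
have kbE t : (0 <= t)%R -> kb t = (b * expR (b * t))%R.
  by move=> t0; rewrite /kb exponential_pdfE// opprK mulNr opprK.
have kbN t : (t < 0)%R -> kb t = 0%R.
  by move=> t0; rewrite /kb lt0_exponential_pdf// oppr0.
have kb0 t : (0 <= kb t)%R.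
  have [t0|t0] := leP 0%R t; first by rewrite kbE// mulr_ge0 ?expR_ge0.
  by rewrite kbN.
have kbint (m : R) : (0 < m)%R ->
    \int[@lebesgueR R]_t (kb t * \1_[set t | (t < m)%R] t)%:E =
    (expR (b * m) - 1)%:E.
  move=> m0; rewrite ge0_integral_lebesgueR//; last 2 first.
  - apply/measurable_EFinP; apply: measurable_funM => //.
    exact: measurable_indic_lt.
  - by move=> t; rewrite lee_fin mulr_ge0.
  transitivity (\int[lebesgue_measure]_(t in `[0%R, m[) (kb t)%:E).
    rewrite [RHS]integral_mkcond; apply: eq_integral => t _.
    have -> : \1_[set t | (t < m)%R] t = (t < m)%R%:R :> R.
      rewrite indicE (_ : (t \in _) = (t < m)%R)//.
      by apply/idP/idP; rewrite inE.
    rewrite patchE mem_setE in_itv/=; have [tm|tm] := ltP t m.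
      by rewrite andbT mulr1; have [//|/kbN ->] := leP 0%R t.
    by rewrite andbF mulr0.
  rewrite integral_itv_bndo_bndc; last first.
    by apply/measurable_EFinP; exact: measurable_funTS.
  have := exponential_prob_itv0c (- b) m0; rewrite /exponential_prob.
  have -> : \int[lebesgue_measure]_(t in `[0%R, m]) (exponential_pdf (- b) t)%:E =
      - \int[lebesgue_measure]_(t in `[0%R, m]) (kb t)%:E.
    rewrite -integral_ge0N; last by move=> t _; rewrite lee_fin.
    by apply: eq_integral => t _; rewrite /kb -EFinN opprK.
  by move=> /(congr1 oppe); rewrite oppeK => ->; rewrite opprK -EFinD -EFinN opprB.
have kbint2 : \int[@lebesgueR R]_t (kb t * expR (- ((n j)%:R * t)))%:E =
    (b / ((n j)%:R - b))%:E.
  rewrite ge0_integral_lebesgueR//; last 2 first.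
  - apply/measurable_EFinP; apply: measurable_funM => //.
    by apply: measurableT_comp => //; apply: measurableT_comp.
  - by move=> t; rewrite lee_fin mulr_ge0 ?expR_ge0.
  have nb0 : (0 < (n j)%:R - b)%R by rewrite subr_gt0.
  transitivity (\int[lebesgue_measure]_t ((b / ((n j)%:R - b))%:E *
      (exponential_pdf ((n j)%:R - b) t)%:E)).
    apply: eq_integral => t _; rewrite -EFinM; congr EFin.
    have [t0|t0] := leP 0%R t; last first.
      by rewrite kbN// lt0_exponential_pdf// mul0r mulr0.
    rewrite kbE// exponential_pdfE// -mulrA -expRD mulrA divfK ?gt_eqF//.
    by congr (_ * expR _)%R; ring.
  rewrite ge0_integralZl//; last 3 first.
  - by apply/measurable_EFinP; exact: measurable_exponential_pdf.
  - by move=> t _; rewrite lee_fin exponential_pdf_ge0// ltW.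
  - by rewrite lee_fin divr_ge0// ltW.
  by rewrite integral_exponential_pdf// mule1.
have mpos : measurable_fun [set: N.-tuple R] (EFin \o \1_pos : _ -> \bar R).
  apply/measurable_EFinP; apply: measurable_indic.
  exact: measurable_positive_orthant.
have mFpos : measurable_fun [set: N.-tuple R] (fun x => F x * (\1_pos x)%:E).
  exact: emeasurable_funM.
pose G (z : N.-tuple R * R) : \bar R :=
  F z.1 * (\1_pos z.1)%:E * (kb z.2 * \1_[set t | (t < M j z.1)%R] z.2)%:E.
have G0 z : 0 <= G z by rewrite !mule_ge0// lee_fin// mulr_ge0.
have mG : measurable_fun setT G.
  apply: emeasurable_funM.
    exact: (measurableT_comp mFpos measurable_fst).
  apply/measurable_EFinP; apply: measurable_funM.
    exact: (measurableT_comp mkb measurable_snd).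
  rewrite (_ : (fun _ => _) =
    \1_[set z : N.-tuple R * R | (z.2 < M j z.1)%R]); last first.
    by apply/funext => z; rewrite !indicE.
  apply: measurable_indic; rewrite -[X in measurable X]setTI.
  apply: measurable_lt_fun => //.
  exact: (measurableT_comp (mM j) measurable_fst).
rewrite integral_positive_orthant; last 2 first.
- by move=> x; rewrite mule_ge0 ?lee_fin ?expR_ge0.
- apply: emeasurable_funM => //; apply/measurable_EFinP.
  apply: measurableT_comp => //; apply: measurable_funM => //.
transitivity (\int[q]_x (F x * (\1_pos x)%:E + \int[@lebesgueR R]_t G (x, t))).
  apply: eq_integral => x _.
  rewrite /G /= ge0_integralZl//; last 3 first.
  - apply/measurable_EFinP; apply: measurable_funM => //.
    exact: measurable_indic_lt.
  - by move=> t _; rewrite lee_fin mulr_ge0.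
  - by rewrite mule_ge0// lee_fin.
  rewrite indicE; case: (asboolP (pos x)) => [px|npx]; last first.
    by rewrite memNset// !mule0 mul0e adde0.
  have M0 : (0 < M j x)%R.
    by apply/lt_group_minP => // a _; exact: (positive_orthantP x).1.
  rewrite mem_set// !mule1 kbint//.
  rewrite -[X in X + _]mule1 -ge0_muleDr ?lee_fin//.
    by rewrite -EFinD addrC subrK.
  by rewrite subr_ge0 -expR0 ler_expR mulr_ge0// ltW.
pose lm : {sigma_finite_measure set R -> \bar R} := @lebesgueR R.
have mGt : measurable_fun [set: N.-tuple R]
    (fun x => \int[@lebesgueR R]_t G (x, t)).
  exact: (@measurable_fun_fubini_tonelli_F _ _ _ _ _ lm G mG G0).
rewrite ge0_integralD//; last 2 first.
- by move=> x _; rewrite mule_ge0// lee_fin.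
- by move=> x _; exact: integral_ge0.
rewrite -integral_positive_orthant//.
rewrite (@fubini_tonelli _ _ _ _ _ q (@lebesgueR R))//=.
transitivity (\int[q]_x F x + \int[@lebesgueR R]_t
   ((kb t * expR (- ((n j)%:R * t)))%:E * \int[q]_x F x)).
  congr (_ + _); apply: eq_integral => t _.
  have [t0|t0] := leP 0%R t; last first.
    rewrite kbN// mul0r mul0e integral0_eq// => x _.
    by rewrite /G/= kbN// mul0r mule0.
  have mFM : measurable_fun [set: N.-tuple R]
      (fun x => F x * (\1_[set x | (t < M j x)%R] x)%:E).
    apply: emeasurable_funM => //; apply/measurable_EFinP.
    apply: measurable_indic; rewrite -[X in measurable X]setTI.
    exact: measurable_lt_fun.
  rewrite EFinM -muleA -(group_min_tail j)//.
  rewrite (integral_positive_orthant (F := fun x => _ * _))//; last first.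
    by move=> x; rewrite mule_ge0// lee_fin.
  rewrite -ge0_integralZl//; last 3 first.
  - exact: emeasurable_funM.
  - by move=> x _; rewrite !mule_ge0// lee_fin.
  - by rewrite lee_fin.
  apply: eq_integral => x _; rewrite /G/= EFinM.
  have -> : \1_[set t' | (t' < M j x)%R] t =
      \1_[set x | (t < M j x)%R] x :> R by rewrite !indicE.
  rewrite muleCA; congr (_ * _); rewrite -!muleA; congr (_ * _); exact: muleC.
rewrite ge0_integralZr//; last 3 first.
- apply/measurable_EFinP; apply: measurable_funM => //.
  apply: measurableT_comp => //; apply: measurableT_comp => //.
- by move=> t _; rewrite lee_fin mulr_ge0 ?expR_ge0.
- exact: integral_ge0.
rewrite kbint2 -[X in X + _]mul1e -ge0_muleDl; last 2 first.
- by [].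
- by rewrite lee_fin divr_ge0// subr_ge0 ltW.
congr (_ * _); rewrite -EFinD; congr EFin.
by field; rewrite subr_eq0 gt_eqF.
Qed.

Definition spreads (x : N.-tuple R) : k.-tuple R := [tuple T j x | j < k].

Lemma tnth_spreads x j : tnth (spreads x) j = T j x.
Proof. exact: tnth_mktuple. Qed.

Lemma measurable_spreads : measurable_fun [set: N.-tuple R] spreads.
Proof.
apply/measurable_fun_tnthP => j.
have -> : (fun t => tnth t j) \o spreads = T j.
  by apply/funext => x; exact: tnth_spreads.
exact: mT.
Qed.

End standard_groups.

Section tuple_scale.
Context (R : realType) (k : nat).
Implicit Types (c : 'I_k -> R) (t : k.-tuple R).

Definition tuple_scale c t : k.-tuple R := tuple_map (fun j y => c j * y) t.

Lemma tnth_tuple_scale c t j : tnth (tuple_scale c t) j = c j * tnth t j.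
Proof. exact: tnth_mktuple. Qed.

Lemma measurable_tuple_scale c : measurable_fun [set: k.-tuple R] (tuple_scale c).
Proof. by apply: measurable_tuple_map => j; exact: measurable_funM. Qed.

Lemma tuple_scale1 t : tuple_scale (fun=> 1) t = t.
Proof. by apply: eq_from_tnth => j; rewrite tnth_tuple_scale mul1r. Qed.

Lemma tuple_scale_comp c c' t :
  tuple_scale c (tuple_scale c' t) = tuple_scale (fun j => c j * c' j) t.
Proof.
apply: eq_from_tnth => j; rewrite tnth_tuple_scale [in LHS]tnth_tuple_scale.
by rewrite tnth_tuple_scale mulrA.
Qed.

Definition scale_at (j : 'I_k) (r : R) : 'I_k -> R :=
  fun j' => if j' == j then r else 1.

Lemma scale_at_gt0 j (r : R) : 0 < r -> forall j', 0 < scale_at j r j'.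
Proof. by move=> r0 j'; rewrite /scale_at; case: ifP. Qed.

End tuple_scale.

Section spread_tilting.
Local Open Scope ereal_scope.
Context (R : realType) (N k : nat) (g : 'I_N -> 'I_k).
Hypothesis g_surj : forall j, exists a, g a = j.
Variable q : probability (N.-tuple R) R.
Hypothesis q_law : product_law q (fun=> exp_law 0 (@ltr01 R)).

Local Notation n := (group_size g).
Local Notation M := (@group_min R N k g).
Local Notation T := (@group_spread R N k g).
Local Notation S := (@spreads R N k g).

Lemma spreads_affine (b s : 'I_k -> R) x : (forall j, (0 < s j)%R) ->
  S (group_affine g b s x) = tuple_scale s (S x).
Proof.
move=> s0; apply: eq_from_tnth => j.
by rewrite tnth_spreads tnth_tuple_scale tnth_spreads group_spread_affine.
Qed.

Let mM j := measurable_group_min (R := R) g_surj j.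

(** Dividing group [j] by [lam] multiplies the standard density by
    [expR ((1 - lam) * s)] up to a constant, where [s] is the sum of the group.
    As [s] is the spread plus [n j] times the minimum, compensating the
    minimum, whose effect is known from [group_min_expectation], leaves a tilt
    by the spread alone.  For [1 <= lam] the compensating factor is increasing
    in the minimum, as required there. *)
Let spread_tilt_ge1 j (lam : R) (f : k.-tuple R -> \bar R) : (1 <= lam)%R ->
  (forall t, 0 <= f t) -> measurable_fun [set: k.-tuple R] f ->
  \int[q]_x (f (S x) * (expR ((1 - lam) * T j x))%:E) =
  (lam ^- (n j).-1)%:E *
  \int[q]_x f (tuple_scale (scale_at j lam^-1%R) (S x)).
Proof.
move=> lam1 f0 mf; have lam0 : (0 < lam)%R by exact: lt_le_trans lam1.
have n0 : (0 < n j)%N.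
  by have [a /eqP ga] := g_surj j; apply/card_gt0P; exists a.
have s0 : forall j', (0 < scale_at j lam^-1 j')%R.
  by apply: scale_at_gt0; rewrite invr_gt0.
set s := scale_at j lam^-1%R in s0 *.
have mfT : measurable_fun [set: N.-tuple R] (f \o S).
  by apply: measurableT_comp => //; exact: measurable_spreads.
have mexp (h : N.-tuple R -> R) (c : R) : measurable_fun [set: N.-tuple R] h ->
    measurable_fun [set: N.-tuple R] (fun x => (expR (c * h x))%:E : \bar R).
  move=> mh; apply/measurable_EFinP; apply: measurableT_comp => //.
  exact: measurable_funM.
pose F x := f (S x) * (expR ((lam - 1) * (n j)%:R * M j x))%:E.
have F0 x : 0 <= F x by rewrite mule_ge0// lee_fin expR_ge0.
have mF : measurable_fun [set: N.-tuple R] F.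
  by apply: emeasurable_funM => //; exact: mexp.
have FE x : F (group_affine g (fun=> 0%R) s x) =
    f (tuple_scale s (S x)) *
    (expR ((lam - 1) * (n j)%:R / lam * M j x))%:E.
  rewrite /F spreads_affine// group_min_affine// add0r.
  by rewrite [s j]/s /scale_at eqxx mulrA.
have s0a a : (0 < s (g a))%R by [].
have := @standard_affine _ _ q q_law (fun=> 0%R) (fun a => s (g a)) F
  (fun=> lexx _) s0a F0 mF.
have -> : (fun x => F (tuple_map (fun a y => 0 + s (g a) * y)%R x)) =
    (fun x => f (tuple_scale s (S x)) *
      (expR ((lam - 1) * (n j)%:R / lam * M j x))%:E).
  by apply/funext => x; exact: FE.
have mscf : measurable_fun [set: N.-tuple R] (fun x => f (tuple_scale s (S x))).
  apply: (measurableT_comp mf); apply: measurableT_comp.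
    exact: measurable_tuple_scale.
  exact: measurable_spreads.
have nR0 : (0 < (n j)%:R :> R)%R by rewrite ltr0n.
rewrite (group_min_expectation g_surj q_law (F := fun x => f (tuple_scale s (S x))))//;
    last 2 first.
- apply/andP; split.
    by apply: divr_ge0; last exact: ltW; rewrite mulr_ge0// subr_ge0.
  by rewrite ltr_pdivrMr// mulrBl mul1r mulrC gtrBl.
- by move=> c x; rewrite spreads_affine// tuple_scale1.
have -> : ((n j)%:R - (lam - 1) * (n j)%:R / lam = (n j)%:R / lam :> R)%R.
  by field; rewrite gt_eqF.
rewrite invf_div mulrCA mulfV ?gt_eqF// mulr1 => lamE.
have mtilt : measurable_fun [set: N.-tuple R]
    (fun x => f (S x) * (expR ((1 - lam) * T j x))%:E).
  by apply: emeasurable_funM => //; apply: mexp; exact: measurable_group_spread.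
have prodE x : F x * (\prod_a affine_ratio 0 (s (g a)) (tnth x a))%:E =
    (lam ^+ n j)%:E *
    (f (S x) * (expR ((1 - lam) * T j x))%:E * (\1_(@positive_orthant R N) x)%:E).
  rewrite prod_affine_ratio -/(@positive_orthant R N).
  have -> : (\prod_a ((s (g a))^-1 * expR (tnth x a - (tnth x a - 0) / s (g a))) =
     lam ^+ n j * (expR ((1 - lam) * T j x) *
       expR ((1 - lam) * (n j)%:R * M j x)))%R.
    rewrite (eq_bigr (fun a =>
        if g a == j then lam * expR ((1 - lam) * tnth x a) else 1)%R); last first.
      move=> a _; rewrite /s /scale_at; case: ifP => _.
        by rewrite invrK subr0; congr (_ * expR _)%R; ring.
      by rewrite invr1 mul1r mulr1 subr0 subrr expR0.
    rewrite -big_mkcond/= big_split/= prodr_const; congr (_ * _)%R.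
    rewrite -expR_sum -mulr_sumr group_sum_spread -expRD; congr expR.
    by ring.
  rewrite /F -!muleA [RHS]muleCA; congr (_ * _); rewrite -!EFinM; congr EFin.
  have e12 : (expR ((lam - 1) * (n j)%:R * M j x) *
      expR ((1 - lam) * (n j)%:R * M j x) = 1)%R.
    by rewrite -expRD -[RHS]expR0; congr expR; ring.
  by rewrite -[RHS]mul1r -[X in _ = (X * _)%R]e12; ring.
move: lamE; rewrite (eq_integral _ _ (fun x _ => prodE x)) ge0_integralZl//;
    last 3 first.
- apply: emeasurable_funM => //; apply/measurable_EFinP/measurable_indic.
  exact: measurable_positive_orthant.
- by move=> x _; rewrite !mule_ge0 ?lee_fin ?expR_ge0.
- by rewrite lee_fin exprn_ge0// ltW.
rewrite -integral_positive_orthant//; last first.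
  by move=> x; rewrite mule_ge0// lee_fin expR_ge0.
move=> /(congr1 (fun y => (lam ^- n j)%:E * y)).
rewrite !muleA -!EFinM mulVf ?mul1e; last by rewrite gt_eqF// exprn_gt0.
move=> <-; congr (_%:E * _).
by rewrite -(prednK n0) exprSr invfM divfK ?gt_eqF.
Qed.

Let spread_tilt j (lam : R) (f : k.-tuple R -> \bar R) : (0 < lam)%R ->
  (forall t, 0 <= f t) -> measurable_fun [set: k.-tuple R] f ->
  \int[q]_x (f (S x) * (expR ((1 - lam) * T j x))%:E) =
  (lam ^- (n j).-1)%:E *
  \int[q]_x f (tuple_scale (scale_at j lam^-1%R) (S x)).
Proof.
move=> lam0 f0 mf; have [lam1|/ltW lam1] := leP 1%R lam.
  exact: spread_tilt_ge1.
(* The identity for the inverse factor, read backwards. *)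
pose f' t := f (tuple_scale (scale_at j lam^-1%R) t) *
  (expR ((lam^-1 - 1) * tnth t j))%:E.
have f'0 t : 0 <= f' t by rewrite mule_ge0// lee_fin expR_ge0.
have mf' : measurable_fun [set: k.-tuple R] f'.
  apply: emeasurable_funM.
    by apply: (measurableT_comp mf); exact: measurable_tuple_scale.
  apply/measurable_EFinP; apply: measurableT_comp => //.
  by apply: measurable_funM => //; exact: measurable_tnth.
have := @spread_tilt_ge1 j lam^-1 f'; rewrite -{1}invr1 lef_pV2 ?posrE//.
move=> /(_ lam1 f'0 mf'); rewrite invrK exprVn invrK.
rewrite (eq_integral (fun x => f (tuple_scale (scale_at j lam^-1%R) (S x))));
    last first.
  move=> x _; rewrite /f' tnth_spreads -muleA -EFinM -expRD -mulrDl.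
  by rewrite addrC addrA subrK subrr mul0r expR0 mule1.
move=> ->; rewrite muleA -EFinM mulVf ?mul1e; last first.
  by rewrite gt_eqF// exprn_gt0.
apply: eq_integral => x _; rewrite /f' tuple_scale_comp.
have -> : (fun j' => scale_at j lam^-1 j' * scale_at j lam j')%R = fun=> 1%R.
  apply/funext => j'; rewrite /scale_at; case: ifP => _; last by rewrite mulr1.
  by apply: mulVf; rewrite gt_eqF.
rewrite tuple_scale1 tnth_tuple_scale tnth_spreads /scale_at eqxx.
by congr (_ * (expR _)%:E); field; rewrite gt_eqF.
Qed.

(** The spreads form an exponential family: changing the scales of the groups
    multiplies their joint law by an exponential factor.  This encodes that
    they are independent Gamma variables of shapes [(n j).-1], and it is the
    only property of their law that the comparison of risks needs. *)
Lemma spreads_tilt (lam : 'I_k -> R) (f : k.-tuple R -> \bar R) :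
  (forall j, (0 < lam j)%R) ->
  (forall t, 0 <= f t) -> measurable_fun [set: k.-tuple R] f ->
  \int[q]_x (f (S x) * (expR (\sum_j (1 - lam j) * tnth (S x) j))%:E) =
  (\prod_j lam j ^- (n j).-1)%:E *
  \int[q]_x f (tuple_scale (fun j => (lam j)^-1)%R (S x)).
Proof.
move=> lam0 f0 mf.
suff main s : uniq s -> forall f : k.-tuple R -> \bar R, (forall t, 0 <= f t) ->
    measurable_fun [set: k.-tuple R] f ->
    \int[q]_x (f (S x) * (expR (\sum_(j <- s) (1 - lam j) * tnth (S x) j))%:E) =
    (\prod_(j <- s) lam j ^- (n j).-1)%:E * \int[q]_x
      f (tuple_scale (fun j => if j \in s then (lam j)^-1 else 1)%R (S x)).
  have := main _ (index_enum_uniq 'I_k) f f0 mf.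
  rewrite (_ : (fun j => if j \in _ then _ else _) = fun j => (lam j)^-1%R)//.
  by apply/funext => j; rewrite mem_index_enum.
elim: s {f f0 mf} => [_ f f0 mf|j s IH /= /andP[js us] f f0 mf].
  rewrite big_nil mul1e; apply: eq_integral => x _.
  by rewrite big_nil expR0 mule1 (tuple_scale1 (S x)).
pose f1 t := f t * (expR (\sum_(j <- s) (1 - lam j) * tnth t j))%:E.
have f10 t : 0 <= f1 t by rewrite mule_ge0// lee_fin expR_ge0.
have mf1 : measurable_fun [set: k.-tuple R] f1.
  apply: emeasurable_funM => //; apply/measurable_EFinP.
  apply: measurableT_comp => //; apply: measurable_sum => j'.
  by apply: measurable_funM => //; exact: measurable_tnth.
transitivity (\int[q]_x (f1 (S x) * (expR ((1 - lam j) * T j x))%:E)).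
  apply: eq_integral => x _; rewrite /f1 -muleA -EFinM -expRD big_cons.
  by rewrite addrC tnth_spreads.
rewrite spread_tilt// big_cons EFinM -muleA; congr (_ * _).
pose f2 t := f (tuple_scale (scale_at j (lam j)^-1%R) t).
have mf2 : measurable_fun [set: k.-tuple R] f2.
  by apply: (measurableT_comp mf); exact: measurable_tuple_scale.
transitivity (\int[q]_x (f2 (S x) *
    (expR (\sum_(j <- s) (1 - lam j) * tnth (S x) j))%:E)).
  apply: eq_integral => x _; rewrite /f1 /f2; congr (_ * (expR _)%:E).
  rewrite big_seq [RHS]big_seq; apply: eq_bigr => j' j's.
  rewrite tnth_tuple_scale /scale_at; case: eqP => [jj'|_]; last by rewrite mul1r.
  by rewrite -jj' j's in js.
have f20 t : 0 <= f2 t by exact: f0.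
rewrite (IH us f2 f20 mf2); congr (_ * _); apply: eq_integral => x _.
rewrite /f2 tuple_scale_comp; congr (f (tuple_scale _ _)).
apply/funext => j'; rewrite /scale_at in_cons.
have [->|_] := eqVneq j' j; last by rewrite mul1r.
by rewrite (negbTE js) mulr1.
Qed.

End spread_tilting.

(** * Convexity of the linex loss *)

Section linex_gap.
Context (R : realType).
Implicit Types p c e s : R.

Lemma linexE p s delta : linex p s delta = linex p 1 (delta / s).
Proof. by rewrite /linex divr1. Qed.

Lemma linex_ge0 p s delta : 0 <= linex p s delta.
Proof.
rewrite /linex -addrA -opprD subr_ge0 addrC; exact: expR_ge1Dx.
Qed.

(** The excess of the loss at [c * s] over the loss at [c' * s], minus the
    linear term whose slope is the derivative of the loss at [e * s]. *)
Definition linex_gap p e c c' s : R :=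
  linex p 1 (c * s) - linex p 1 (c' * s) -
  p * (c - c') * s * (expR (p * (e * s - 1)) - 1).

(** The first term is the convexity gap between [c] and [c'], and the second
    compares the slopes of the loss at [c' * s] and at [e * s]. *)
Lemma linex_gapE p e c c' s : linex_gap p e c c' s =
  expR (p * (c' * s - 1)) *
    (expR (p * (c - c') * s) - (1 + p * (c - c') * s)) +
  p * (c - c') * s * (expR (p * (c' * s - 1)) - expR (p * (e * s - 1))).
Proof.
rewrite /linex_gap /linex !divr1.
have -> : p * (c * s - 1) = p * (c' * s - 1) + p * (c - c') * s by ring.
by rewrite expRD; ring.
Qed.

Let cross_ge0 p e c c' s : 0 <= s -> (c <= c' <= e) || (e <= c' <= c) ->
  0 <= p * (c - c') * s * (expR (p * (c' * s - 1)) - expR (p * (e * s - 1))).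
Proof.
move=> s0 cc'; rewrite mulrAC; apply: mulr_ge0 => //; rewrite -mulrA.
have [p0|p0] := leP 0 p; case/orP : cc' => /andP[h1 h2].
- apply: mulr_ge0 => //; apply: mulr_le0; rewrite subr_le0// ler_expR.
  by rewrite ler_wpM2l// lerD2r ler_wpM2r.
- apply: mulr_ge0 => //; apply: mulr_ge0; rewrite subr_ge0// ler_expR.
  by rewrite ler_wpM2l// lerD2r ler_wpM2r.
- apply: mulr_le0; first exact: ltW.
  apply: mulr_le0_ge0; rewrite ?subr_le0 ?subr_ge0// ler_expR.
  by rewrite ler_wnM2l ?(ltW p0)// lerD2r ler_wpM2r.
- apply: mulr_le0; first exact: ltW.
  apply: mulr_ge0_le0; rewrite ?subr_le0 ?subr_ge0// ler_expR.
  by rewrite ler_wnM2l ?(ltW p0)// lerD2r ler_wpM2r.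
Qed.

(** If [c'] lies between [c] and [e], the slope of the convex loss changes
    monotonically along the way, so both terms are nonnegative. *)
Lemma linex_gap_ge0 p e c c' s : 0 <= s ->
  (c <= c' <= e) || (e <= c' <= c) -> 0 <= linex_gap p e c c' s.
Proof.
move=> s0 cc'; rewrite linex_gapE addr_ge0 ?cross_ge0//.
by rewrite mulr_ge0 ?expR_ge0// subr_ge0 expR_ge1Dx.
Qed.

Lemma linex_gap_gt0 p e c c' s : p != 0 -> 0 < s -> c != c' ->
  (c <= c' <= e) || (e <= c' <= c) -> 0 < linex_gap p e c c' s.
Proof.
move=> p0 s0 cc'0 cc'; rewrite linex_gapE; apply: ltr_pwDl.
  apply: mulr_gt0; first exact: expR_gt0.
  by rewrite subr_gt0 expR_gt1Dx// !mulf_neq0 ?subr_eq0// gt_eqF.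
by apply: cross_ge0 => //; exact: ltW.
Qed.

End linex_gap.

(** * Measurability and nonnegative integrals *)

Section measure_lemmas.
Context (R : realType).

Lemma measurable_invr : measurable_fun [set: R] (@GRing.inv R).
Proof.
have -> : [set: R] = [set 0] `|` [set x | x != 0].
  by apply/seteqP; split=> // x _; have [->|x0] := eqVneq x 0; [left|right].
have ne0 : open [set x : R | x != 0] by exact: open_neq.
apply/measurable_funU => //; first exact: open_measurable.
split; first exact: measurable_fun_set1.
apply: open_continuous_measurable_fun => // x; rewrite inE => /= x0.
exact: inv_continuous.
Qed.

Context d (T : measurableType d) (mu : {measure set T -> \bar R}).

Lemma measurable_neq_fun (f g : T -> R) :
  measurable_fun [set: T] f -> measurable_fun [set: T] g ->
  measurable [set x | f x <> g x].
Proof.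
move=> mf mg; have -> : [set x | f x <> g x] = (f \- g) @^-1` (~` [set 0]).
  apply/seteqP; split=> x /= fg; apply: contra_not fg.
    by move/eqP; rewrite subr_eq0 => /eqP.
  by move=> ->; rewrite subrr.
rewrite -[X in measurable X]setTI; apply: measurable_funB => //.
exact: measurableC.
Qed.

Lemma measurable_linex (p s : R) (f : T -> R) : measurable_fun [set: T] f ->
  measurable_fun [set: T] (fun x => linex p s (f x)).
Proof.
move=> mf.
have mdiff : measurable_fun [set: T] (fun x => p * (f x / s - 1)).
  apply: measurable_funM => //; apply: measurable_funB => //.
  exact: measurable_funM.
apply: measurable_funB => //; apply: measurable_funB => //.
exact: measurableT_comp.
Qed.

Lemma measurable_linex_gap (p e : R) (c c' s : T -> R) :
  measurable_fun [set: T] c -> measurable_fun [set: T] c' ->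
  measurable_fun [set: T] s ->
  measurable_fun [set: T] (fun x => linex_gap p e (c x) (c' x) (s x)).
Proof.
move=> mc mc' ms; apply: measurable_funB.
  by apply: measurable_funB; apply: measurable_linex; exact: measurable_funM.
apply: measurable_funM.
  apply: measurable_funM => //; apply: measurable_funM => //.
  exact: measurable_funB.
apply: measurable_funB => //; apply: measurableT_comp => //.
apply: measurable_funM => //; apply: measurable_funB => //.
exact: measurable_funM.
Qed.

Local Open Scope ereal_scope.

Lemma ge0_integral_eq0_negligible (f : T -> \bar R) :
  (forall x, 0 <= f x) -> measurable_fun [set: T] f ->
  \int[mu]_x f x = 0 -> mu [set x | f x != 0] = 0.
Proof.
move=> f0 mf If.
have : \int[mu]_x `|f x| = 0.
  by rewrite -[RHS]If; apply: eq_integral => x _; rewrite gee0_abs.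
move=> /(ae_eq_integral_abs mu measurableT mf)[A [mA A0 sub]].
apply/eqP; rewrite eq_le measure_ge0 andbT -[X in _ <= X]A0 le_measure ?inE//.
  by rewrite -[X in measurable X]setTI; exact: emeasurable_neq.
by move=> x /= /eqP fx; apply: sub => /= /(_ I).
Qed.

End measure_lemmas.

(** * Comparison of the risks *)

Section constants.
Context (R : realType) (k : nat) (n : 'I_k -> nat) (p : R).
Hypotheses (p_neq0 : p != 0) (n_ge2 : forall j, (2 <= n j)%N).

Lemma sum_predn : (\sum_j n j)%:R - k%:R + 1 = (\sum_j (n j).-1).+1%:R :> R.
Proof.
have -> : (\sum_j n j = \sum_j (n j).-1 + k)%N.
  rewrite -[X in (_ + X)%N]card_ord -sum1_card -big_split/=.
  by apply: eq_bigr => j _; rewrite addn1 prednK// (leq_trans _ (n_ge2 j)).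
by rewrite natrD addrK -natr1.
Qed.

(** The factor for which the tilt by the total has the exponent
    [p * e_const p n]; the lemma [tilt_factorX] is what makes [e_const p n]
    the optimal multiple of the total. *)
Definition tilt_factor : R := expR (- (p / (\sum_j (n j).-1).+1%:R)).

Lemma tilt_factorE : 1 - tilt_factor = p * e_const p n.
Proof. by rewrite /e_const sum_predn mulrC divfK. Qed.

Lemma tilt_factor_gt0 : 0 < tilt_factor.
Proof. exact: expR_gt0. Qed.

Lemma tilt_factorX : tilt_factor ^- (\sum_j (n j).-1).+1 = expR p.
Proof.
rewrite -expRM_natl -expRN; congr expR.
by field; rewrite addrC natr1 pnatr_eq0.
Qed.

Lemma e_const_gt0 : 0 < e_const p n.
Proof.
have D0 : (0 : R) < (\sum_j (n j).-1).+1%:R by rewrite ltr0n.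
rewrite /e_const sum_predn; have [p0|p0] := ltP 0 p.
  rewrite divr_gt0// subr_gt0 -expR0 ltr_expR oppr_lt0.
  exact: divr_gt0.
have {}p0 : p < 0 by rewrite lt_neqAle p_neq0.
rewrite -[X in 0 < X]mulrNN -invrN divr_gt0// ?oppr_gt0// subr_lt0.
by rewrite -expR0 ltr_expR oppr_gt0 ltr_pdivrMr// mul0r.
Qed.

End constants.

Section scaled_spreads.
Context (R : realType) (k : nat) (i : 'I_k) (sigma : 'I_k -> R).
Hypothesis sigma_gt0 : positive_scales sigma.
Implicit Types (t : k.-tuple R) (v : k.-1.-tuple R).

Definition scaled (j : 'I_k) t : R := sigma j * tnth t j.

Local Notation V := (ratios scaled i).

(** The quotient of the total of the spreads by the [i]-th one, as a function
    of the ratios. *)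
Definition ratio_weight v : R :=
  1 + \sum_j tnth v j * (sigma i / sigma (lift i j)).

(** Where [tnth t i] vanishes all the ratios are zero, and so is this
    quantity; elsewhere it is the sum of the entries of [t]. *)
Definition ratio_total t : R := ratio_weight (V t) * tnth t i.

Lemma tnth_ratios t j : tnth (V t) j = scaled (lift i j) t / scaled i t.
Proof. exact: tnth_mktuple. Qed.

Lemma ratio_totalE t : tnth t i != 0 -> ratio_total t = \sum_j tnth t j.
Proof.
move=> ti0; rewrite /ratio_total /ratio_weight mulrDl mul1r mulr_suml.
rewrite (bigD1_ord i)//=; congr (_ + _); apply: eq_bigr => j _.
rewrite tnth_ratios /scaled; field.
by rewrite ti0 !gt_eqF.
Qed.

Lemma ratios_scale (c : R) t : 0 < c ->
  V (tuple_scale (fun=> c) t) = V t.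
Proof.
move=> c0; apply: eq_from_tnth => j; rewrite !tnth_ratios /scaled.
rewrite !tnth_tuple_scale; have [->|ti0] := eqVneq (tnth t i) 0.
  by rewrite !mulr0 !invr0 !mulr0.
by field; rewrite ti0 !gt_eqF.
Qed.

Lemma ratio_total_scale (c : R) t : 0 < c ->
  ratio_total (tuple_scale (fun=> c) t) = c * ratio_total t.
Proof.
by move=> c0; rewrite /ratio_total ratios_scale// tnth_tuple_scale mulrCA.
Qed.

Lemma ratios_ge0 t : (forall j, 0 <= tnth t j) -> forall j, 0 <= tnth (V t) j.
Proof.
by move=> t0 j; rewrite tnth_ratios divr_ge0// mulr_ge0// ltW.
Qed.

Lemma ratio_weight_ge1 v : (forall j, 0 <= tnth v j) -> 1 <= ratio_weight v.
Proof.
move=> v0; rewrite lerDl; apply: sumr_ge0 => j _.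
by rewrite mulr_ge0// divr_ge0// ltW.
Qed.

Lemma ratio_weight_gt0 v : (forall j, 0 <= tnth v j) -> 0 < ratio_weight v.
Proof. by move=> v0; rewrite (lt_le_trans ltr01) ?ratio_weight_ge1. Qed.

Lemma ratio_total_ge0 t : (forall j, 0 <= tnth t j) -> 0 <= ratio_total t.
Proof.
move=> t0; rewrite mulr_ge0// (le_trans ler01)// ratio_weight_ge1//.
exact: ratios_ge0.
Qed.

Lemma ratio_total_le t : (forall j, 0 <= tnth t j) ->
  ratio_total t <= \sum_j tnth t j.
Proof.
move=> t0; have [ti0|/ratio_totalE -> //] := eqVneq (tnth t i) 0.
by rewrite /ratio_total ti0 mulr0 sumr_ge0.
Qed.

Lemma linex_estimator p phi t : (forall j, 0 <= tnth t j) ->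
  linex p (sigma i) (estimator scaled i phi t) =
  linex p 1 (phi (V t) / ratio_weight (V t) * ratio_total t).
Proof.
move=> t0; rewrite linexE; congr linex.
rewrite /estimator /ratio_total /scaled.
have w0 := ratio_weight_gt0 (ratios_ge0 t0).
by rewrite mulrA divfK ?gt_eqF//; field; rewrite gt_eqF.
Qed.

Lemma measurable_ratios : measurable_fun [set: k.-tuple R] V.
Proof.
apply/measurable_fun_tnthP => j.
have -> : (fun v => tnth v j) \o V =
    (fun t => scaled (lift i j) t * (scaled i t)^-1).
  by apply/funext => t; exact: tnth_ratios.
have ms l : measurable_fun [set: k.-tuple R] (scaled l).
  by apply: measurable_funM => //; exact: measurable_tnth.
apply: measurable_funM => //.
exact: (measurableT_comp (@measurable_invr R)).
Qed.

Lemma measurable_ratio_weight :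
  measurable_fun [set: k.-1.-tuple R] ratio_weight.
Proof.
apply: measurable_funD => //; apply: measurable_sum => j.
by apply: measurable_funM => //; exact: measurable_tnth.
Qed.

Lemma measurable_ratio_total : measurable_fun [set: k.-tuple R] ratio_total.
Proof.
apply: measurable_funM; last exact: measurable_tnth.
apply: measurableT_comp; first exact: measurable_ratio_weight.
exact: measurable_ratios.
Qed.

End scaled_spreads.

Section truncation_bounds.
Context (R : realType) (k : nat) (n : 'I_k -> nat) (p : R) (i : 'I_k).
Hypotheses (p_neq0 : p != 0) (n_ge2 : forall j, (2 <= n j)%N).
Variable sigma : 'I_k -> R.
Hypothesis hsigma : ordered_scales sigma.

Let sigma_gt0 : positive_scales sigma. Proof. by case: hsigma. Qed.

Local Notation e := (e_const p n).
Local Notation weight := (ratio_weight i sigma).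

Lemma phi_low_le (v : k.-1.-tuple R) : (forall j, 0 <= tnth v j) ->
  phi_low p n i v <= e * weight v.
Proof.
move=> v0; have [_ smono] := hsigma.
rewrite /phi_low ler_pM2l; last exact: e_const_gt0.
rewrite lerD2l big_mkcond/=; apply: ler_sum => j _; case: ifP => [ji|_].
  by rewrite ler_peMr// ler_pdivlMr// mul1r smono// ltnW.
by rewrite mulr_ge0// divr_ge0// ltW.
Qed.

Lemma le_phi_up (v : k.-1.-tuple R) : (forall j, 0 <= tnth v j) ->
  ((e * weight v)%:E <= phi_up p n i v)%E.
Proof.
move=> v0; have [_ smono] := hsigma.
rewrite /phi_up; case: ifP => [/eqP i0|_]; last by rewrite leey.
rewrite lee_fin ler_pM2l; last exact: e_const_gt0.
rewrite lerD2l; apply: ler_sum => j _.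
by rewrite ler_piMr// ler_pdivrMr// mul1r smono//= i0.
Qed.

(** Dividing by the weight turns both bounds of the truncation into bounds on
    the multiple of the total, with the optimal multiple [e] between them. *)
Lemma truncation_between (phi : k.-1.-tuple R -> R) (v : k.-1.-tuple R) :
  (forall j, 0 <= tnth v j) ->
  let c := phi v / weight v in let c' := truncation p n i phi v / weight v in
  (c <= c' <= e) || (e <= c' <= c).
Proof.
move=> v0 /=; have w0 := ratio_weight_gt0 i sigma_gt0 v0.
have lo := phi_low_le v0; have up := le_phi_up v0.
rewrite !ler_pM2r ?invr_gt0// ler_pdivrMr// ler_pdivlMr//.
rewrite /truncation; case: ifPn => [->|_]; first by rewrite lo.
case: ifPn => [_|]; first by rewrite lexx/= andbT le_total.
rewrite -leNgt; move: up; case: (phi_up p n i v) => [r| |] //=.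
by rewrite !lee_fin => -> ->; rewrite orbT.
Qed.

Lemma measurable_truncation (phi : k.-1.-tuple R -> R) :
  measurable_fun [set: k.-1.-tuple R] phi ->
  measurable_fun [set: k.-1.-tuple R] (truncation p n i phi).
Proof.
move=> mphi.
have mlow : measurable_fun [set: k.-1.-tuple R] (phi_low p n i).
  apply: measurable_funM => //; apply: measurable_funD => //.
  have -> : (fun v : k.-1.-tuple R => \sum_(j < k.-1 | (lift i j < i)%N) tnth v j) =
      (fun v => \sum_(j < k.-1) (if (lift i j < i)%N then tnth v j else 0)).
    by apply/funext => v; rewrite big_mkcond.
  apply: measurable_sum => j; case: (lift i j < i)%N; last exact: measurable_cst.
  exact: measurable_tnth.
have mup : measurable_fun [set: k.-1.-tuple R] (phi_up p n i).
  rewrite /phi_up; case: (val i == 0); last exact: measurable_cst.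
  apply/measurable_EFinP; apply: measurable_funM => //.
  apply: measurable_funD => //; apply: measurable_sum => j.
  exact: measurable_tnth.
rewrite /truncation; apply: measurable_fun_ifT => //.
  exact: measurable_fun_ler.
apply: measurable_fun_ifT => //.
  by apply: measurable_fun_lte => //; exact/measurable_EFinP.
exact: measurableT_comp.
Qed.

End truncation_bounds.

Section risk_comparison.
Local Open Scope ereal_scope.
Context (R : realType) (k : nat) (n : 'I_k -> nat) (p : R) (i : 'I_k).
Hypotheses (p_neq0 : p != 0%R) (n_ge2 : forall j, (2 <= n j)%N).
Context d (X : measurableType d) (q : probability X R) (W : X -> k.-tuple R).
Hypothesis mW : measurable_fun [set: X] W.
Hypothesis W_ge0 : forall x j, (0 <= tnth (W x) j)%R.
Hypothesis W_tilt : forall (lam : 'I_k -> R) (f : k.-tuple R -> \bar R),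
  (forall j, (0 < lam j)%R) ->
  (forall t, 0 <= f t) -> measurable_fun [set: k.-tuple R] f ->
  \int[q]_x (f (W x) * (expR (\sum_j (1 - lam j) * tnth (W x) j))%:E) =
  (\prod_j lam j ^- (n j).-1)%:E *
  \int[q]_x f (tuple_scale (fun j => (lam j)^-1)%R (W x)).

Local Notation e := (e_const p n).

Let msum : measurable_fun [set: X] (fun x => \sum_j tnth (W x) j)%R.
Proof.
apply: measurable_sum => j.
exact: (measurableT_comp (@measurable_tnth _ R k j)).
Qed.

(** The tilt by half the total has a finite mass, and it dominates the total. *)
Lemma integral_sum_spreads_lty :
  \int[q]_x (\sum_j tnth (W x) j)%:E < +oo.
Proof.
have half_gt0 (j : 'I_k) : (0 < 2^-1 :> R)%R by rewrite invr_gt0 ltr0n.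
have := @W_tilt (fun=> 2^-1)%R (fun=> 1); rewrite integral_cst//= probability_setT.
rewrite mule1; under eq_integral do rewrite mul1e.
move=> /(_ half_gt0 (fun=> lee01) (measurable_cst _)) expE.
have mexp : measurable_fun [set: X]
    (fun x => (expR (\sum_j (1 - 2^-1) * tnth (W x) j))%:E : \bar R).
  apply/measurable_EFinP; apply: measurableT_comp => //.
  apply: measurable_sum => j; apply: measurable_funM => //.
  exact: (measurableT_comp (@measurable_tnth _ R k j)).
apply: (@le_lt_trans _ _ (\int[q]_x
    (2%:E * (expR (\sum_j (1 - 2^-1) * tnth (W x) j)%R)%:E))).
  apply: ge0_le_integral => //.
  - by move=> x _; rewrite lee_fin sumr_ge0.
  - exact/measurable_EFinP.
  - exact: emeasurable_funM.
  - move=> x _; rewrite -EFinM lee_fin -mulr_sumr.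
    set s := (\sum_j tnth (W x) j)%R.
    have := expR_ge1Dx ((1 - 2^-1) * s)%R.
    have -> : (1 - 2^-1 = 2^-1 :> R)%R by field.
    move=> h; rewrite -ler_pdivrMl// (le_trans _ h)// lerDr.
    exact: ler01.
by rewrite ge0_integralZl// expE mule1 -EFinM ltry.
Qed.

(** Tilting by a single spread leaves the event that it vanishes unchanged,
    yet multiplies its probability by a factor above one. *)
Lemma spread_eq0_negligible : q [set x | tnth (W x) i == 0%R] = 0.
Proof.
pose A : set (k.-tuple R) := [set t | tnth t i == 0%R].
have mA : measurable A.
  rewrite (_ : A = (fun t : k.-tuple R => tnth t i) @^-1` [set 0%R]).
    by rewrite -[X in measurable X]setTI; exact: measurable_tnth.
  by apply/seteqP; split=> t /= /eqP.
pose f (t : k.-tuple R) : \bar R := (\1_A t)%:E.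
have mf : measurable_fun [set: k.-tuple R] f.
  by apply/measurable_EFinP; exact: measurable_indic.
pose lam : 'I_k -> R := scale_at i 2^-1%R.
have lam0 j : (0 < lam j)%R by apply: scale_at_gt0; rewrite invr_gt0 ltr0n.
have f0 t : 0 <= f t by rewrite lee_fin.
have mB : measurable [set x | tnth (W x) i == 0%R].
  by rewrite -[X in measurable X]setTI; exact: (mW measurableT mA).
have qA : q [set x | tnth (W x) i == 0%R] = \int[q]_x f (W x).
  by rewrite -[X in q X]setIT -integral_indic//; apply: eq_integral.
have := W_tilt lam0 f0 mf.
have -> : \int[q]_x (f (W x) *
    (expR (\sum_j (1 - lam j) * tnth (W x) j))%:E) = \int[q]_x f (W x).
  apply: eq_integral => x _; rewrite /f indicE.
  case: (asboolP (A (W x))) => Ax; last by rewrite memNset// mul0e.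
  rewrite mem_set// mul1e big1 ?expR0// => j _.
  rewrite /lam /scale_at; case: eqP => [->|_]; last by rewrite subrr mul0r.
  by move/eqP : Ax => ->; rewrite mulr0.
have -> : \int[q]_x f (tuple_scale (fun j => (lam j)^-1)%R (W x)) =
    \int[q]_x f (W x).
  apply: eq_integral => x _; rewrite /f !indicE.
  rewrite (_ : (tuple_scale _ _ \in A) = (W x \in A))//.
  apply/idP/idP; rewrite !inE /A/= tnth_tuple_scale mulf_eq0 invr_eq0;
    by rewrite (gt_eqF (lam0 i)).
rewrite (bigD1 i)//= big1 ?mulr1; last first.
  by move=> j /negbTE ji; rewrite /lam /scale_at ji expr1n invr1.
rewrite /lam /scale_at eqxx exprVn invrK -qA.
set a := q _; have afin : a \is a fin_num by exact: fin_num_measure.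
rewrite -[a]fineK// -EFinM => -[] aE; congr EFin.
have n1 : (0 < (n i).-1)%N by case: (n i) (n_ge2 i) => [|[|]].
have : ((2 ^+ (n i).-1 - 1) * fine a = 0)%R.
  by rewrite mulrBl mul1r -aE subrr.
move=> /eqP; rewrite mulf_eq0 subr_eq0 => /orP[|/eqP//].
by rewrite gt_eqF// exprn_egt1// -?lt0n// ltr1n.
Qed.

Section fixed_scales.
Variable sigma : 'I_k -> R.
Hypothesis sigma_gt0 : positive_scales sigma.

Local Notation V := (ratios (scaled sigma) i).
Local Notation S := (ratio_total i sigma).

Let mV : measurable_fun [set: X] (V \o W).
Proof. by apply: measurableT_comp => //; exact: measurable_ratios. Qed.

Let mS : measurable_fun [set: X] (S \o W).
Proof. by apply: measurableT_comp => //; exact: measurable_ratio_total. Qed.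

Let S0 x : (0 <= S (W x))%R.
Proof. by apply: ratio_total_ge0. Qed.

(** The loss has zero expected slope at the optimal multiple [e], even
    conditionally on the ratios: the slope contains the factor that tilts the
    total back to its own law. *)
Lemma integral_total_tilt (h : k.-1.-tuple R -> R) :
  (forall v, (0 <= h v)%R) -> measurable_fun [set: k.-1.-tuple R] h ->
  \int[q]_x (h (V (W x)) * (S (W x) * expR (p * (e * S (W x) - 1))))%:E =
  \int[q]_x (h (V (W x)) * S (W x))%:E.
Proof.
move=> h0 mh; pose lam := tilt_factor n p.
have lam0 : (0 < lam)%R by exact: tilt_factor_gt0.
pose f (t : k.-tuple R) := (h (V t) * `|S t|)%:E.
have f0 t : 0 <= f t by rewrite lee_fin mulr_ge0.
have mf : measurable_fun [set: k.-tuple R] f.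
  apply/measurable_EFinP; apply: measurable_funM.
    by apply: (measurableT_comp mh); exact: measurable_ratios.
  by apply: measurableT_comp => //; exact: measurable_ratio_total.
have := W_tilt (fun=> lam0) f0 mf.
rewrite (_ : \prod_j lam ^- (n j).-1 = lam ^- (\sum_j (n j).-1))%R; last first.
  by rewrite -prodrXr -prodfV.
have -> : \int[q]_x f (tuple_scale (fun=> lam^-1)%R (W x)) =
    (lam^-1)%:E * \int[q]_x (h (V (W x)) * S (W x))%:E.
  rewrite -ge0_integralZl//; last 3 first.
  - apply/measurable_EFinP; apply: measurable_funM => //.
    exact: (measurableT_comp mh).
  - by move=> x _; rewrite lee_fin mulr_ge0.
  - by rewrite lee_fin invr_ge0 ltW.
  apply: eq_integral => x _; rewrite /f ratios_scale ?invr_gt0//.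
  rewrite ratio_total_scale ?invr_gt0// ger0_norm; last first.
    by rewrite mulr_ge0// invr_ge0 ltW.
  by rewrite -EFinM mulrCA.
rewrite muleA -EFinM -invfM -exprSr tilt_factorX.
move=> /(congr1 (fun y => (expR (- p))%:E * y)).
rewrite [X in _ = X -> _]muleA -EFinM -expRD addNr expR0 mul1e => <-.
rewrite -ge0_integralZl//; last 2 first.
- apply: emeasurable_funM; first exact: (measurableT_comp mf).
  apply/measurable_EFinP; apply: measurableT_comp => //.
  apply: measurable_sum => j; apply: measurable_funM => //.
  exact: (measurableT_comp (@measurable_tnth _ R k j)).
- by move=> x _; rewrite mule_ge0// lee_fin expR_ge0.
apply: eq_integral => x _; rewrite /f ger0_norm//.
have [Wi0|Wi0] := eqVneq (tnth (W x) i) 0%R.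
  by rewrite /ratio_total Wi0 !mulr0 mul0r mulr0 !mul0e mule0.
rewrite -mulr_sumr tilt_factorE// -(ratio_totalE sigma_gt0 Wi0).
rewrite -!EFinM; congr EFin.
have -> : (p * (e * S (W x) - 1) = - p + p * e * S (W x))%R by ring.
by rewrite expRD; ring.
Qed.

Lemma integral_total_lty : \int[q]_x (S (W x))%:E < +oo.
Proof.
apply: le_lt_trans integral_sum_spreads_lty; apply: ge0_le_integral => //.
- by move=> x _; rewrite lee_fin.
- exact/measurable_EFinP.
- exact/measurable_EFinP.
- by move=> x _; rewrite lee_fin ratio_total_le.
Qed.

Lemma bounded_integral_total_lty (h : k.-1.-tuple R -> R) (N : nat) :
  (forall v, (0 <= h v <= N%:R)%R) -> measurable_fun [set: k.-1.-tuple R] h ->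
  \int[q]_x (h (V (W x)) * S (W x))%:E < +oo.
Proof.
move=> h0N mh; apply: (@le_lt_trans _ _ (\int[q]_x (N%:R%:E * (S (W x))%:E))).
  have mhS : measurable_fun [set: X] (fun x => (h (V (W x)) * S (W x))%:E : \bar R).
    apply/measurable_EFinP; apply: measurable_funM => //.
    exact: (measurableT_comp mh).
  apply: ge0_le_integral => //.
  - by move=> x _; rewrite lee_fin mulr_ge0//; case/andP: (h0N (V (W x))).
  - by apply: emeasurable_funM => //; exact/measurable_EFinP.
  - move=> x _; rewrite -EFinM lee_fin ler_wpM2r//.
    by case/andP: (h0N (V (W x))).
rewrite ge0_integralZl//; last 2 first.
- exact/measurable_EFinP.
- by move=> x _; rewrite lee_fin.
have If : \int[q]_x (S (W x))%:E \is a fin_num.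
  rewrite ge0_fin_numE ?integral_total_lty// integral_ge0// => x _.
  by rewrite lee_fin.
by rewrite -(fineK If) -EFinM ltry.
Qed.

(** The excess risk is the expected gap.  The linear correction in the gap
    has mean zero on every set where the difference of the two rules is
    bounded, and these sets exhaust the space. *)
Lemma risk_gap (c c' : k.-1.-tuple R -> R) :
  measurable_fun [set: k.-1.-tuple R] c ->
  measurable_fun [set: k.-1.-tuple R] c' ->
  (forall x, (0 <= linex_gap p e (c (V (W x))) (c' (V (W x))) (S (W x)))%R) ->
  \int[q]_x (linex p 1 (c (V (W x)) * S (W x)))%:E =
  \int[q]_x (linex p 1 (c' (V (W x)) * S (W x)))%:E +
  \int[q]_x (linex_gap p e (c (V (W x))) (c' (V (W x))) (S (W x)))%:E.
Proof.
move=> mc mc' gap0.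
pose l (b : k.-1.-tuple R -> R) x := linex p 1 (b (V (W x)) * S (W x)).
pose gap x := linex_gap p e (c (V (W x))) (c' (V (W x))) (S (W x)).
have mbS (b : k.-1.-tuple R -> R) : measurable_fun [set: k.-1.-tuple R] b ->
    measurable_fun [set: X] (fun x => b (V (W x)) * S (W x))%R.
  by move=> mb; apply: measurable_funM => //; exact: (measurableT_comp mb).
have ml (b : k.-1.-tuple R -> R) : measurable_fun [set: k.-1.-tuple R] b ->
    measurable_fun [set: X] (l b).
  by move=> mb; apply: measurable_linex; exact: mbS.
have mE : measurable_fun [set: X] (fun x => expR (p * (e * S (W x) - 1)))%R.
  apply: measurableT_comp => //; apply: measurable_funM => //.
  by apply: measurable_funB => //; exact: measurable_funM.
pose D v := (p * (c v - c' v))%R.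
have mD : measurable_fun [set: k.-1.-tuple R] D.
  by apply: measurable_funM => //; exact: measurable_funB.
have mgap : measurable_fun [set: X] gap.
  by apply: measurable_linex_gap => //; apply: (measurableT_comp _ mV).
rewrite -ge0_integralD//; last 4 first.
- by move=> x _; rewrite lee_fin linex_ge0.
- by apply/measurable_EFinP; exact: ml.
- by move=> x _; rewrite lee_fin.
- exact/measurable_EFinP.
pose B N : set (k.-1.-tuple R) := [set v | (`|D v| <= N%:R)%R].
have mB N : measurable (B N).
  rewrite -[X in measurable X]setTI.
  have mt : measurable [set true] by [].
  have mle : measurable_fun [set: k.-1.-tuple R] (fun v => `|D v| <= N%:R)%R.
    by apply: measurable_fun_ler => //; exact: measurableT_comp.
  have := mle measurableT _ mt.
  by rewrite (_ : _ @^-1` _ = B N).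
pose A N : set X := (V \o W) @^-1` B N.
have mA N : measurable (A N).
  by rewrite -[X in measurable X]setTI; exact: mV.
have AU : \bigcup_N A N = setT.
  apply/seteqP; split=> // x _; exists (Num.truncn `|D (V (W x))|).+1 => //=.
  by apply: ltW; exact: truncnS_gt.
have Ahomo : {homo A : N M / (N <= M)%N >-> (N <= M)%O}.
  move=> N M NM; apply/subsetPset => x /= h; apply: le_trans h _.
  by rewrite ler_nat.
suff AE N : \int[q]_(x in A N) (l c x)%:E =
    \int[q]_(x in A N) ((l c' x)%:E + (gap x)%:E).
  have ml1 : measurable_fun [set: X] (fun x => (l c x)%:E : \bar R).
    by apply/measurable_EFinP; exact: ml.
  have ml2 : measurable_fun [set: X] (fun x => (l c' x)%:E + (gap x)%:E).
    by apply: emeasurable_funD; apply/measurable_EFinP => //; exact: ml.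
  have lim1 := @ge0_nondecreasing_set_cvg_integral _ _ _ A
    (fun x => (l c x)%:E) q Ahomo mA (fun N => measurable_funTS ml1)
    (fun N x _ => linex_ge0 _ _ _).
  have l20 N x : A N x -> 0 <= (l c' x)%:E + (gap x)%:E.
    move=> _; rewrite -EFinD lee_fin; apply: addr_ge0; first exact: linex_ge0.
    exact: gap0.
  have lim2 := @ge0_nondecreasing_set_cvg_integral _ _ _ A
    (fun x => (l c' x)%:E + (gap x)%:E) q Ahomo mA
    (fun N => measurable_funTS ml2)
    l20.
  rewrite AU in lim1 lim2; rewrite (funext AE) in lim1.
  exact: (cvg_unique _ lim1 lim2).
(* The linear term is split into its positive and negative parts so that every
   integral is the integral of a nonnegative function. *)
pose hp v := (Num.max (D v) 0 * \1_(B N) v)%R.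
pose hm v := (Num.max (- D v) 0 * \1_(B N) v)%R.
have hpN v : (0 <= hp v <= N%:R)%R.
  rewrite /hp indicE; case: (asboolP (B N v)) => h.
    rewrite mem_set// mulr1 le_max lexx orbT/= ge_max ler0n andbT.
    exact: le_trans (ler_norm _) h.
  by rewrite memNset// mulr0 lexx ler0n.
have hmN v : (0 <= hm v <= N%:R)%R.
  rewrite /hm indicE; case: (asboolP (B N v)) => h.
    rewrite mem_set// mulr1 le_max lexx orbT/= ge_max ler0n andbT.
    by apply: le_trans (ler_norm _) _; rewrite normrN.
  by rewrite memNset// mulr0 lexx ler0n.
have hp0 v : (0 <= hp v)%R by case/andP: (hpN v).
have hm0 v : (0 <= hm v)%R by case/andP: (hmN v).
have m1B : measurable_fun [set: k.-1.-tuple R] (\1_(B N) : _ -> R).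
  exact: measurable_indic.
have mhp : measurable_fun [set: k.-1.-tuple R] hp.
  by apply: measurable_funM => //; apply: measurable_maxr.
have mhm : measurable_fun [set: k.-1.-tuple R] hm.
  apply: measurable_funM => //; apply: measurable_maxr => //.
  exact: measurableT_comp.
pose SE x := (S (W x) * expR (p * (e * S (W x) - 1)))%R.
have SE0 x : (0 <= SE x)%R by rewrite mulr_ge0 ?expR_ge0.
have mSE : measurable_fun [set: X] SE by exact: measurable_funM.
have mh (h : k.-1.-tuple R -> R) (Z : X -> R) : measurable_fun [set: k.-1.-tuple R] h ->
    measurable_fun [set: X] Z ->
    measurable_fun [set: X] (fun x => (h (V (W x)) * Z x)%:E : \bar R).
  move=> mh mZ; apply/measurable_EFinP; apply: measurable_funM => //.
  exact: (measurableT_comp mh).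
pose Ip := \int[q]_x (hp (V (W x)) * S (W x))%:E.
pose Im := \int[q]_x (hm (V (W x)) * S (W x))%:E.
have Ifin : Ip + Im \is a fin_num.
  rewrite ge0_fin_numE; last first.
    by apply: adde_ge0; apply: integral_ge0 => x _; rewrite lee_fin mulr_ge0.
  by apply: lte_add_pinfty; apply: bounded_integral_total_lty.
pose L1 x := (l c x * \1_(A N) x)%R.
pose L2 x := ((l c' x + gap x) * \1_(A N) x)%R.
have m1A : measurable_fun [set: X] (\1_(A N) : _ -> R).
  exact: measurable_indic.
have L10 x : (0 <= L1 x)%R by apply: mulr_ge0 => //; exact: linex_ge0.
have L20 x : (0 <= L2 x)%R.
  by apply: mulr_ge0 => //; apply: addr_ge0; [exact: linex_ge0|exact: gap0].
have mL1 : measurable_fun [set: X] (fun x => (L1 x)%:E : \bar R).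
  by apply/measurable_EFinP; apply: measurable_funM => //; exact: ml.
have mL2 : measurable_fun [set: X] (fun x => (L2 x)%:E : \bar R).
  apply/measurable_EFinP; apply: measurable_funM => //.
  by apply: measurable_funD => //; exact: ml.
have L1E : \int[q]_(x in A N) (l c x)%:E = \int[q]_x (L1 x)%:E.
  rewrite integral_mkcond; apply: eq_integral => x _.
  by rewrite patchE /L1 indicE; case: (x \in A N); rewrite ?mulr1 ?mulr0.
have L2E : \int[q]_(x in A N) ((l c' x)%:E + (gap x)%:E) = \int[q]_x (L2 x)%:E.
  rewrite integral_mkcond; apply: eq_integral => x _.
  by rewrite patchE /L2 indicE; case: (x \in A N); rewrite ?mulr1 ?mulr0.
suff : \int[q]_x (L1 x)%:E + (Ip + Im) = \int[q]_x (L2 x)%:E + (Ip + Im).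
  by rewrite L1E L2E => /(congr1 (fun y => y - (Ip + Im))); rewrite !addeK.
have IpE : Ip = \int[q]_x (hp (V (W x)) * SE x)%:E.
  by rewrite integral_total_tilt.
have ImE : Im = \int[q]_x (hm (V (W x)) * SE x)%:E.
  by rewrite integral_total_tilt.
rewrite [in LHS]ImE [in RHS]IpE.
have add3 (f1 f2 f3 : X -> \bar R) :
    (forall x, 0 <= f1 x) -> measurable_fun [set: X] f1 ->
    (forall x, 0 <= f2 x) -> measurable_fun [set: X] f2 ->
    (forall x, 0 <= f3 x) -> measurable_fun [set: X] f3 ->
    \int[q]_x f1 x + (\int[q]_x f2 x + \int[q]_x f3 x) =
    \int[q]_x (f1 x + (f2 x + f3 x)).
  move=> f10 mf1 f20 mf2 f30 mf3; rewrite -ge0_integralD// -ge0_integralD//.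
    by move=> x _; exact: adde_ge0.
  exact: emeasurable_funD.
have Epos (h : k.-1.-tuple R -> R) (Z : X -> R) : (forall v, (0 <= h v)%R) ->
    (forall x, (0 <= Z x)%R) -> forall x, 0 <= (h (V (W x)) * Z x)%:E.
  by move=> h0 Z0 x; rewrite lee_fin mulr_ge0.
rewrite /Ip /Im add3; [|by []|by []|exact: Epos|exact: mh|exact: Epos|exact: mh].
rewrite [RHS]add3; [|by []|by []|exact: Epos|exact: mh|exact: Epos|exact: mh].
apply: eq_integral => x _; rewrite -!EFinD; congr EFin.
have maxE (r : R) : (Num.max r 0 = r + Num.max (- r) 0)%R.
  rewrite /Num.max oppr_lt0; case: (ltrgt0P r) => // [r0|r0|->].
  - by rewrite addr0.
  - by rewrite subrr.
  - by rewrite oppr0 addr0.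
rewrite /L1 /L2 (_ : \1_(A N) x = \1_(B N) (V (W x))); last by rewrite !indicE.
rewrite /hp /hm (maxE (D _)) /gap /linex_gap /SE -/(l c x) -/(l c' x) /D.
by ring.
Qed.

End fixed_scales.

(** Two scale vectors give equivalent laws of the ratios, because one law is
    an exponential tilt of the other. *)
Lemma ratios_null_sets (sigma tau : 'I_k -> R) (E : set (k.-1.-tuple R)) :
  positive_scales sigma -> positive_scales tau -> measurable E ->
  q [set x | E (ratios (scaled sigma) i (W x))] = 0 ->
  q [set x | E (ratios (scaled tau) i (W x))] = 0.
Proof.
move=> sigma0 tau0 mE qE0.
pose f (t : k.-tuple R) : \bar R := (\1_E (ratios (scaled sigma) i t))%:E.
have f0 t : 0 <= f t by rewrite lee_fin.
have m1E : measurable_fun [set: k.-1.-tuple R] (\1_E : _ -> R).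
  exact: measurable_indic.
have mf : measurable_fun [set: k.-tuple R] f.
  apply/measurable_EFinP; apply: (measurableT_comp m1E).
  exact: measurable_ratios.
have mset s : measurable [set x | E (ratios (scaled s) i (W x))].
  rewrite -[X in measurable X]setTI.
  have mVs : measurable_fun [set: X] (ratios (scaled s) i \o W).
    by apply: measurableT_comp => //; exact: measurable_ratios.
  exact: (mVs measurableT _ mE).
pose lam j := (sigma j / tau j)%R.
have lam0 j : (0 < lam j)%R by rewrite divr_gt0.
have := W_tilt lam0 f0 mf.
have -> : \int[q]_x (f (W x) *
    (expR (\sum_j (1 - lam j) * tnth (W x) j))%:E) = 0.
  transitivity (\int[q]_(x in [set x | E (ratios (scaled sigma) i (W x))])
      (expR (\sum_j (1 - lam j) * tnth (W x) j))%:E).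
    rewrite [RHS]integral_mkcond; apply: eq_integral => x _.
    rewrite patchE /f indicE.
    rewrite (_ : (x \in _) = (ratios (scaled sigma) i (W x) \in E)); last first.
      by apply/idP/idP; rewrite !inE.
    by case: (_ \in E); rewrite ?mul1e ?mul0e.
  apply: null_set_integral => //.
  apply/measurable_EFinP; apply: measurable_funTS; apply: measurableT_comp => //.
  apply: measurable_sum => j; apply: measurable_funM => //.
  exact: (measurableT_comp (@measurable_tnth _ R k j)).
have -> : \int[q]_x f (tuple_scale (fun j => (lam j)^-1)%R (W x)) =
    q [set x | E (ratios (scaled tau) i (W x))].
  rewrite -[X in q X]setIT -integral_indic//; apply: eq_integral => x _.
  have VE : ratios (scaled sigma) i
      (tuple_scale (fun j => (lam j)^-1)%R (W x)) = ratios (scaled tau) i (W x).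
    apply: eq_from_tnth => j; rewrite tnth_ratios [RHS]tnth_ratios /scaled.
    rewrite tnth_tuple_scale tnth_tuple_scale.
    have sE l : (sigma l * ((lam l)^-1 * tnth (W x) l) = tau l * tnth (W x) l)%R.
      by rewrite /lam; field; rewrite !gt_eqF.
    by rewrite sE sE.
  rewrite /f VE !indicE.
  have -> : (x \in [set x | E (ratios (scaled tau) i (W x))]) =
      (ratios (scaled tau) i (W x) \in E) by apply/idP/idP; rewrite !inE.
  by [].
move=> /esym/eqP; rewrite mule_eq0 => /orP[|/eqP//].
rewrite eqe gt_eqF//; apply: prodr_gt0 => j _.
by rewrite invr_gt0 exprn_gt0.
Qed.

Section domination.
Variables (phi : k.-1.-tuple R -> R) (sigma : 'I_k -> R).
Hypothesis mphi : measurable_fun [set: k.-1.-tuple R] phi.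
Hypothesis hsigma : ordered_scales sigma.

Let sigma_gt0 : positive_scales sigma. Proof. by case: hsigma. Qed.

Local Notation phi0 := (truncation p n i phi).
Local Notation V := (ratios (scaled sigma) i).
Local Notation weight := (ratio_weight i sigma).
Local Notation S := (ratio_total i sigma).
Local Notation model_risk psi := (\int[q]_x
  (linex p (sigma i) (estimator (scaled sigma) i psi (W x)))%:E).

Let gap x := linex_gap p e (phi (V (W x)) / weight (V (W x)))
  (phi0 (V (W x)) / weight (V (W x))) (S (W x)).

Let gap_ge0 x : (0 <= gap x)%R.
Proof.
apply: linex_gap_ge0; first exact: ratio_total_ge0.
by apply: truncation_between => //; exact: ratios_ge0.
Qed.

Let mdiv (psi : k.-1.-tuple R -> R) : measurable_fun [set: k.-1.-tuple R] psi ->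
  measurable_fun [set: k.-1.-tuple R] (fun v => psi v / weight v)%R.
Proof.
move=> mpsi; apply: measurable_funM => //.
apply: (measurableT_comp (@measurable_invr R)).
exact: measurable_ratio_weight.
Qed.

Let mphi0 := measurable_truncation n p i mphi.

Lemma truncation_risk_gap :
  model_risk phi = model_risk phi0 + \int[q]_x (gap x)%:E.
Proof.
have riskE (psi : k.-1.-tuple R -> R) : model_risk psi = \int[q]_x
    (linex p 1 (psi (V (W x)) / weight (V (W x)) * S (W x)))%:E.
  by apply: eq_integral => x _; rewrite linex_estimator.
rewrite (riskE phi) (riskE phi0); apply: (risk_gap sigma_gt0 (mdiv mphi) (mdiv mphi0)).
exact: gap_ge0.
Qed.

Lemma truncation_risk_le : model_risk phi0 <= model_risk phi.
Proof.
rewrite truncation_risk_gap leeDl// integral_ge0// => x _.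
by rewrite lee_fin gap_ge0.
Qed.

Lemma truncation_risk_lt : model_risk phi0 < +oo ->
  q [set x | phi0 (V (W x)) <> phi (V (W x))] != 0 ->
  model_risk phi0 < model_risk phi.
Proof.
(* A zero mean would make the gap vanish almost everywhere, and then the two
   rules would agree almost everywhere, as the [i]-th spread is almost surely
   positive. *)
move=> fin neq0; rewrite truncation_risk_gap lteDl; last first.
  rewrite ge0_fin_numE// integral_ge0// => x _; by rewrite lee_fin linex_ge0.
rewrite lt0e integral_ge0 ?andbT; last by move=> x _; rewrite lee_fin gap_ge0.
apply/eqP => gap_eq0; move/eqP: neq0; apply.
have mV : measurable_fun [set: X] (V \o W).
  by apply: measurableT_comp => //; exact: measurable_ratios.
have mgap : measurable_fun [set: X] (fun x => (gap x)%:E).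
  apply/measurable_EFinP; apply: measurable_linex_gap.
  - exact: (measurableT_comp (mdiv mphi) mV).
  - exact: (measurableT_comp (mdiv mphi0) mV).
  - by apply: measurableT_comp => //; exact: measurable_ratio_total.
have gapE0 x : 0 <= (gap x)%:E by rewrite lee_fin gap_ge0.
have N1 : q [set x | (gap x)%:E != 0] = 0.
  exact: ge0_integral_eq0_negligible gapE0 mgap gap_eq0.
have N2 := spread_eq0_negligible.
have mN1 : measurable [set x | (gap x)%:E != 0].
  by rewrite -[X in measurable X]setTI; exact: emeasurable_neq.
have mN2 : measurable [set x | tnth (W x) i == 0%R].
  rewrite (_ : mkset _ = ((fun t => tnth t i) \o W) @^-1` [set 0%R]).
    rewrite -[X in measurable X]setTI.
    by apply: (measurableT_comp (@measurable_tnth _ R k i) mW).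
  by apply/seteqP; split=> x /= /eqP.
have mneq : measurable [set x | phi0 (V (W x)) <> phi (V (W x))].
  apply: measurable_neq_fun; first exact: (measurableT_comp mphi0).
  exact: (measurableT_comp mphi).
apply/eqP; rewrite -measure_le0.
have : q ([set x | (gap x)%:E != 0] `|` [set x | tnth (W x) i == 0%R]) <= 0.
  by rewrite -[leRHS]N1 (measureU0 mN1 mN2 N2).
apply: le_trans; rewrite le_measure ?inE//; first exact: measurableU.
move=> x /= neq; have [Wi0|Wi0] := eqVneq (tnth (W x) i) 0%R; [by right|left].
have t0 : forall j, (0 <= tnth (W x) j)%R by [].
rewrite eqe gt_eqF//; apply: linex_gap_gt0 => //.
- rewrite lt_neqAle eq_sym ratio_total_ge0// andbT.
  rewrite /ratio_total mulf_neq0// gt_eqF//.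
  by apply: ratio_weight_gt0 => //; exact: ratios_ge0.
- have w0 : (0 < weight (V (W x)))%R.
    by apply: ratio_weight_gt0 => //; exact: ratios_ge0.
  apply/eqP => /(congr1 (fun y => y * weight (V (W x)))%R).
  by rewrite !divfK ?gt_eqF// => /esym.
- by apply: truncation_between => //; exact: ratios_ge0.
Qed.

End domination.

End risk_comparison.

(** * From the samples to the standard model *)

Section flattened_samples.
Context (R : realType) (k : nat) (n : 'I_k -> nat).
Hypothesis n_ge2 : forall j, (2 <= n j)%N.

Let I := {j : 'I_k & 'I_(n j)}.

(** All the observations are numbered consecutively; this is the sample that
    an observation belongs to. *)
Definition sample_group (a : 'I_#|{: I}|) : 'I_k := tag (enum_val a).

Lemma big_sample_group (T : Type) (idx : T) (op : Monoid.com_law idx) (j : 'I_k)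
    (F : I -> T) :
  \big[op/idx]_(a | sample_group a == j) F (enum_val a) =
  \big[op/idx]_(l < n j) F (Tagged (fun j => 'I_(n j)) l).
Proof.
transitivity (\big[op/idx]_(u : I | tag u == j) F u).
  apply/esym; transitivity (\big[op/idx]_(u in {: I} | tag u == j) F u) => //.
  exact: (big_enum_val_cond (fun u : I => tag u == j) F).
have := @sig_big_dep _ _ op _ (fun j => 'I_(n j) : finType) (pred1 j)
  (fun _ _ => true) (fun j l => F (Tagged (fun j => 'I_(n j)) l)).
rewrite big_pred1_eq => ->; apply: eq_big => [u|u _]; first by rewrite andbT.
by rewrite taggedK.
Qed.

Lemma sample_group_surj j : exists a, sample_group a = j.
Proof.
have n0 : (0 < n j)%N by exact: leq_trans (n_ge2 j).
exists (enum_rank (Tagged (fun j => 'I_(n j)) (Ordinal n0))).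
by rewrite /sample_group enum_rankK.
Qed.

Lemma group_size_sample j : group_size sample_group j = n j.
Proof.
rewrite /group_size -sum1_card.
by rewrite (big_sample_group _ j (fun=> 1%N)) sum1_card card_ord.
Qed.

Context d (Omega : measurableType d)
  (X : forall j : 'I_k, 'I_(n j) -> {mfun Omega >-> R}).
Arguments X : clear implicits.

Definition flat_sample (w : Omega) : (#|{: I}|).-tuple R :=
  [tuple X _ (tagged (enum_val a)) w | a < #|{: I}|].

Lemma measurable_flat_sample : measurable_fun [set: Omega] flat_sample.
Proof.
apply/measurable_fun_tnthP => a.
have -> : (fun x => tnth x a) \o flat_sample = X _ (tagged (enum_val a)).
  by apply/funext => w; exact: tnth_mktuple.
exact: measurable_funP.
Qed.

Lemma tnth_flat_sample w a :
  tnth (flat_sample w) a = X _ (tagged (enum_val a)) w.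
Proof. exact: tnth_mktuple. Qed.

Lemma statT_flat j w : statT (fun l => X j l : Omega -> R) w =
  group_spread sample_group j (flat_sample w).
Proof.
have minE : sample_min (fun l => X j l : Omega -> R) w =
    group_min sample_group j (flat_sample w).
  congr inf; apply/seteqP; split=> [_ [l _ <-]|_ [a ga <-]].
    exists (enum_rank (Tagged (fun j => 'I_(n j)) l)).
      by rewrite /= /sample_group enum_rankK.
    by rewrite tnth_flat_sample enum_rankK.
  rewrite tnth_flat_sample; move: ga; rewrite /= /sample_group.
  by case: (enum_val a) => j' l /= jj'; subst j'; exists l.
rewrite /statT /group_spread minE -(big_sample_group _ j (fun u =>
  X _ (tagged u) w - group_min sample_group j (flat_sample w))).
by apply: eq_bigr => a _; rewrite tnth_flat_sample.
Qed.

End flattened_samples.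

Section sample_law.
Context (R : realType) (k : nat) (n : 'I_k -> nat).
Hypothesis n_ge2 : forall j, (2 <= n j)%N.
Context d (Omega : measurableType d)
  (X : forall j : 'I_k, 'I_(n j) -> {mfun Omega >-> R}).
Arguments X : clear implicits.
Variable P : ('I_k -> R) -> ('I_k -> R) -> probability Omega R.
Hypothesis hX : forall mu sigma, positive_scales sigma ->
  exp_samples X (P mu sigma) mu sigma.

Local Notation N := #|{: {j : 'I_k & 'I_(n j)}}|.
Local Notation g := (@sample_group k n).
Local Notation Y := (flat_sample X).

Lemma sample_product_law mu sigma (sigma_gt0 : positive_scales sigma) :
  product_law (fun A => P mu sigma (Y @^-1` A))
    (fun a => exp_law (mu (g a)) (sigma_gt0 (g a))).
Proof.
move=> B mB; have [law indep] := hX mu sigma_gt0.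
have := indep (fun u => B (enum_rank u)) (fun u => mB _).
have -> : \bigcap_u ((fun w => X _ (tagged u) w) @^-1` B (enum_rank u)) =
    Y @^-1` rectangle B.
  apply/seteqP; split=> [w h a|w h u _] /=.
    by have := h (enum_val a) I; rewrite /= enum_valK tnth_flat_sample.
  by have := h (enum_rank u); rewrite tnth_flat_sample enum_rankK.
move=> ->; rewrite (big_enum_val (A := {: {j : 'I_k & 'I_(n j)}})) /=.
apply: eq_bigr => a _; rewrite enum_valK exp_lawE//.
by rewrite -(law _ (tagged (enum_val a)) _ (mB a)).
Qed.

Let zero_one : positive_scales (fun _ : 'I_k => 1 : R).
Proof. by move=> j; exact: ltr01. Qed.

HB.instance Definition _ := @isMeasurableFun.Build _ _ _ _ Y
  (measurable_flat_sample X).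

Definition standard_law : probability (N.-tuple R) R :=
  distribution (P (fun=> 0) (fun=> 1)) Y.

Lemma standard_law_product : product_law standard_law (fun=> exp_law 0 (@ltr01 R)).
Proof.
move=> B mB; rewrite [LHS](sample_product_law _ zero_one mB).
by apply: eq_bigr => a _; rewrite !exp_lawE.
Qed.

Lemma sample_law_affine mu sigma (A : set (N.-tuple R)) :
  positive_scales sigma -> measurable A ->
  P mu sigma (Y @^-1` A) = standard_law (group_affine g mu sigma @^-1` A).
Proof.
move=> sigma0 mA.
have maff : measurable_fun [set: N.-tuple R] (group_affine g mu sigma).
  exact: measurable_group_affine.
have mpsi a : measurable_fun [set: R] (fun y => mu (g a) + sigma (g a) * y).
  by apply: measurable_funD => //; exact: measurable_funM.
pose Q' : {measure set (N.-tuple R) -> \bar R} :=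
  pushforward standard_law (group_affine g mu sigma).
have Q'law : product_law (Q' maff)
    (fun a => exp_law (mu (g a)) (sigma0 (g a))).
  move=> B mB.
  rewrite [LHS](product_law_pushforward standard_law_product mpsi mB).
  by apply: eq_bigr => a _; rewrite exp_law_affine.
apply: (product_law_unique (Q := distribution (P mu sigma) Y) (Q' := Q' maff)
  (sample_product_law mu sigma0) Q'law) => // a.
by rewrite exp_law_affine// preimage_setT exp_law_total ltry.
Qed.

Lemma sample_integral_affine mu sigma (F : N.-tuple R -> \bar R) :
  positive_scales sigma -> (forall x, (0 <= F x)%E) ->
  measurable_fun [set: N.-tuple R] F ->
  (\int[P mu sigma]_w F (Y w) =
   \int[standard_law]_x F (group_affine g mu sigma x))%E.
Proof.
move=> sigma0 F0 mF.
have maff : measurable_fun [set: N.-tuple R] (group_affine g mu sigma).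
  exact: measurable_group_affine.
rewrite -[LHS](@ge0_integral_distribution _ _ _ _ _ _ Y)//.
transitivity (\int[pushforward standard_law (group_affine g mu sigma)]_x F x)%E.
  by apply: eq_measure_integral => A mA _; exact: sample_law_affine.
by rewrite ge0_integral_pushforward.
Qed.

End sample_law.

(** * Domination *)

(* Without hfin the claim fails: for p > 0, k = 2, sigma_2 as the estimated
   scale, phi v = 0 for v < 1 and phi v = v ^+ 2 for v >= 1, both estimators
   have risk +oo at every parameter.  The hypothesis is necessary, being implied
   by domination; by the risk comparison it holds as soon as the original
   estimator has finite risk at some parameter. *)
Theorem theorem3p2 (R : realType) (k : nat) (n : 'I_k -> nat) (p : R)
    (d : measure_display) (Omega : measurableType d)
    (X : forall i : 'I_k, 'I_(n i) -> {mfun Omega >-> R})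
    (P : ('I_k -> R) -> ('I_k -> R) -> probability Omega R)
    (i : 'I_k) (phi : k.-1.-tuple R -> R)
    (T := fun j : 'I_k => statT (fun l : 'I_(n j) => X j l : Omega -> R))
    (phi0 := truncation p n i phi)
    (hk : (2 <= k)%N) (hn : forall j, (2 <= n j)%N) (hp : p != 0)
    (hX : forall mu sigma, positive_scales sigma ->
            exp_samples X (P mu sigma) mu sigma)
    (hphi : measurable_fun [set: k.-1.-tuple R] phi)
    (hneq : exists mu sigma, positive_scales sigma /\
       (0 < P mu sigma [set w | phi0 (ratios T i w) <> phi (ratios T i w)])%E)
    (hfin : exists mu sigma, ordered_scales sigma /\
       (risk (P mu sigma) p (sigma i) (estimator T i phi0) < +oo)%E) :
  dominates P p i (estimator T i phi0) (estimator T i phi).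
Proof.
pose N := #|{: {j : 'I_k & 'I_(n j)}}|.
pose g : 'I_N -> 'I_k := @sample_group k n; pose Y := flat_sample X.
have gsurj := sample_group_surj hn.
pose q := standard_law X P.
pose W : N.-tuple R -> k.-tuple R := spreads g.
have mW : measurable_fun setT W by exact: measurable_spreads.
have W0 x j : 0 <= tnth (W x) j.
  by rewrite tnth_spreads; exact: group_spread_ge0.
have Wtilt (lam : 'I_k -> R) (f : k.-tuple R -> \bar R) :
    (forall j, 0 < lam j) -> (forall t, (0 <= f t)%E) ->
    measurable_fun [set: k.-tuple R] f ->
    (\int[q]_x (f (W x) * (expR (\sum_j (1 - lam j) * tnth (W x) j))%:E) =
    (\prod_j lam j ^- (n j).-1)%:E *
    \int[q]_x f (tuple_scale (fun j => (lam j)^-1)%R (W x)))%E.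
  move=> lam0 f0 mf.
  rewrite (spreads_tilt gsurj (standard_law_product hX) lam0 f0 mf).
  congr (_%:E * _)%E; apply: eq_bigr => j _.
  by rewrite group_size_sample.
have TE j w : T j w = group_spread g j (Y w) by exact: statT_flat.
have affE (sigma mu : 'I_k -> R) x j : positive_scales sigma ->
    group_spread g j (group_affine g mu sigma x) = scaled sigma j (W x).
  by move=> s0; rewrite group_spread_affine// /scaled tnth_spreads.
have ratiosE w : ratios T i w = ratios (group_spread g) i (Y w).
  by apply: eq_from_tnth => j; rewrite !tnth_mktuple !TE.
have ratios_aff (sigma mu : 'I_k -> R) x : positive_scales sigma ->
    ratios (group_spread g) i (group_affine g mu sigma x) =
    ratios (scaled sigma) i (W x).
  by move=> s0; apply: eq_from_tnth => j; rewrite !tnth_mktuple !affE.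
have mspread j : measurable_fun [set: N.-tuple R] (group_spread g j).
  exact: measurable_group_spread.
have mratios : measurable_fun [set: N.-tuple R] (ratios (group_spread g) i).
  apply/measurable_fun_tnthP => j.
  have -> : (fun v => tnth v j) \o ratios (group_spread g) i =
      (fun x : N.-tuple R => group_spread g (lift i j) x / group_spread g i x).
    by apply: funext => x; exact: tnth_mktuple.
  apply: measurable_funM => //.
  exact: (measurableT_comp (@measurable_invr R)).
have riskE mu sigma (psi : k.-1.-tuple R -> R) : positive_scales sigma ->
    measurable_fun setT psi ->
    (risk (P mu sigma) p (sigma i) (estimator T i psi) =
     \int[q]_x (linex p (sigma i) (estimator (scaled sigma) i psi (W x)))%:E)%E.
  move=> s0 mpsi; rewrite /risk expectation.unlock.
  pose G x := (linex p (sigma i) (estimator (group_spread g) i psi x))%:E.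
  transitivity (\int[P mu sigma]_w G (Y w))%E.
    by apply: eq_integral => w _; rewrite /estimator ratiosE TE.
  rewrite (sample_integral_affine hX)//; last 2 first.
  - by move=> x; rewrite lee_fin linex_ge0.
  - apply/measurable_EFinP; apply: measurable_linex; apply: measurable_funM => //.
    exact: (measurableT_comp mpsi).
  apply: eq_integral => x _.
  by rewrite /G /estimator ratios_aff// affE.
have mphi0 : measurable_fun setT phi0 by exact: measurable_truncation.
pose E : set (k.-1.-tuple R) := [set v | phi0 v <> phi v].
have mE : measurable E by exact: measurable_neq_fun.
have probE mu sigma : positive_scales sigma ->
    P mu sigma [set w | phi0 (ratios T i w) <> phi (ratios T i w)] =
    q [set x | E (ratios (scaled sigma) i (W x))].
  move=> s0.
  have mA : measurable (ratios (group_spread g) i @^-1` E).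
    by rewrite -[X in measurable X]setTI; exact: mratios.
  have := sample_law_affine hX mu s0 mA.
  have -> : Y @^-1` (ratios (group_spread g) i @^-1` E) =
      [set w | phi0 (ratios T i w) <> phi (ratios T i w)].
    by apply/seteqP; split=> w; rewrite /E /= ratiosE.
  move=> ->; congr (q _).
  by apply/seteqP; split=> x; rewrite /= ratios_aff.
split=> [mu sigma hs|].
  have [s0 _] := hs; rewrite !riskE//.
  exact: (truncation_risk_le i hp hn mW W0 Wtilt hphi hs).
have [mu1 [sigma1 [hs1 fin]]] := hfin.
have [mu2 [sigma2 [s2 neq]]] := hneq.
have [s1 _] := hs1.
exists sigma1; split=> // mu; rewrite !riskE//.
apply: (truncation_risk_lt (i := i) hp hn mW W0 Wtilt hphi hs1).
  by rewrite -(riskE mu1).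
apply/eqP => /(ratios_null_sets mW Wtilt s1 s2 mE) q0.
by move: neq; rewrite probE// q0 ltxx.
Qed.
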